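(* Let $A$ be a finite set, $n\ge3$, and let $\rho\subseteq A^n$ be an essential key relation preserved by a WNU, whose pattern is the full equivalence relation on $\{1,\dots,n\}$. Then: (1) every block of $\rho$ equals $B_1\times\dots\times B_n$ for some $B_1,\dots,B_n\subseteq A$; (2) for every nontrivial block $\boldsymbol B=B_1\times\dots\times B_n$ there exist an abelian group $(G;+)$ whose order is a power of a prime and surjective maps $\phi_i:B_i\to G$ ($i=1,\dots,n$) such that $$\rho\cap\boldsymbol B=\{(x_1,\dots,x_n)\in\boldsymbol B:\ \phi_1(x_1)+\dots+\phi_n(x_n)=0\}.$$
   Context: A tuple $\alpha\in A^n\setminus\rho$ is essential for $\rho$ if for every $i$ some tuple obtained from $\alpha$ by changing only its $i$-th coordinate lies in $\rho$. $\widetilde\rho$ denotes $\rho$ together with all essential tuples for $\rho$. Consider the graph whose vertices are the tuples of $\widetilde\rho$, two tuples being adjacent if they differ in exactly one coordinate; a block of $\rho$ is a connected component of this graph, and a block is trivial if it contains only tuples of $\rho$ (nontrivial otherwise). A unary vector-function is a tuple $\Psi=(\psi_1,\dots,\psi_n)$ of maps $\psi_i:A\to A$ acting coordinatewise; it preserves $\rho$ if $\Psi(\rho)\subseteq\rho$. $\rho$ is a key relation if there is $\beta\in A^n\setminus\rho$ (a key tuple) such that every $\alpha\in A^n\setminus\rho$ is mapped to $\beta$ by some unary vector-function preserving $\rho$. $\rho$ is essential if it cannot be written as a conjunction of relations of smaller arities. A WNU is an $m$-ary ($m\ge2$) operation $f$ on $A$ with $f(x,\dots,x)=x$ and $f(y,x,\dots,x)=f(x,y,x,\dots,x)=\dots=f(x,\dots,x,y)$;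 it preserves $\rho$ if applying it coordinatewise to any $m$ tuples of $\rho$ gives a tuple of $\rho$. The pattern of $\rho$: for $i\ne j$, $i\overset{\rho}{\sim}j$ iff there do NOT exist $a_1,\dots,a_n,b_i,b_j\in A$ with $(a_1,\dots,a_n)\notin\rho$ while the tuples obtained by replacing $a_i$ by $b_i$, replacing $a_j$ by $b_j$, and replacing both, all lie in $\rho$; the pattern is full if $i\overset{\rho}{\sim}j$ for all $i,j$. *)

(* Defs.v *)
From HB Require Import structures.
From mathcomp Require Import all_boot all_order all_algebra.
Set Implicit Arguments. Unset Strict Implicit. Unset Printing Implicit Defensive.
Import GRing.Theory.

Section RelDefs.
Variables (A : finType) (n : nat).

Definition tup := {ffun 'I_n -> A}.

Definition upd (I : finType) (a : {ffun I -> A}) (i : I) (b : A) : {ffun I -> A} :=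
  [ffun j => if j == i then b else a j].

Definition essential_tuple (rho : {set tup}) (a : tup) : Prop :=
  a \notin rho /\ forall i : 'I_n, exists b : A, upd a i b \in rho.

Definition rho_tilde (rho : {set tup}) : {set tup} :=
  [set a | (a \in rho) || [forall i : 'I_n, exists b : A, upd a i b \in rho]].

Definition adj (a b : tup) : bool := #|[set i : 'I_n | a i != b i]| == 1.

Definition tilde_edge (rho : {set tup}) : rel tup :=
  fun a b => [&& a \in rho_tilde rho, b \in rho_tilde rho & adj a b].

Definition is_block (rho : {set tup}) (Bk : {set tup}) : Prop :=
  exists2 a, a \in rho_tilde rho &
    Bk = [set b | (b \in rho_tilde rho) && connect (tilde_edge rho) a b].

Definition trivial_block (rho : {set tup}) (Bk : {set tup}) : bool := Bk \subset rho.

Definition vapply (Psi : 'I_n -> A -> A) (a : tup) : tup := [ffun i => Psi i (a i)].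

Definition vpreserves (Psi : 'I_n -> A -> A) (rho : {set tup}) : Prop :=
  forall a, a \in rho -> vapply Psi a \in rho.

Definition key_relation (rho : {set tup}) : Prop :=
  exists beta : tup, beta \notin rho /\
    forall a : tup, a \notin rho ->
      exists Psi : 'I_n -> A -> A, vpreserves Psi rho /\ vapply Psi a = beta.

(* a conjunction of relations of smaller arities: each constraint is a k < n,
   a choice of variables f : 'I_k -> 'I_n and a relation sigma on A^k,
   encoding the atom sigma(x_{f 0}, ..., x_{f (k-1)}) *)
Definition constraint := {k : 'I_n & (('I_k -> 'I_n) * {set {ffun 'I_k -> A}})%type}.

Definition sat_constraint (a : tup) (c : constraint) : bool :=
  [ffun j => a ((tagged c).1 j)] \in (tagged c).2.

Definition essential_rel (rho : {set tup}) : Prop :=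
  ~ exists s : seq constraint, rho = [set a | all (sat_constraint a) s].

Definition is_WNU (m : nat) (f : {ffun 'I_m -> A} -> A) : Prop :=
  (2 <= m)%N /\
  (forall x : A, f [ffun => x] = x) /\
  (forall (x y : A) (i j : 'I_m), f (upd [ffun => x] i y) = f (upd [ffun => x] j y)).

Definition fpreserves (m : nat) (f : {ffun 'I_m -> A} -> A) (rho : {set tup}) : Prop :=
  forall rows : 'I_m -> tup, (forall k, rows k \in rho) ->
    [ffun i => f [ffun k => rows k i]] \in rho.

Definition preserved_by_WNU (rho : {set tup}) : Prop :=
  exists (m : nat) (f : {ffun 'I_m -> A} -> A), is_WNU f /\ fpreserves f rho.

Definition pattern_rel (rho : {set tup}) (i j : 'I_n) : Prop :=
  ~ exists (a : tup) (bi bj : A),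
      [/\ a \notin rho, upd a i bi \in rho, upd a j bj \in rho
        & upd (upd a i bi) j bj \in rho].

Definition full_pattern (rho : {set tup}) : Prop :=
  forall i j : 'I_n, i != j -> pattern_rel rho i j.

Definition box (Bs : 'I_n -> {set A}) : {set tup} :=
  [set a : tup | [forall i, a i \in Bs i]].

End RelDefs.

(* Main.v *)
Require Import Defs.
From HB Require Import structures.
From mathcomp Require Import all_boot all_order all_algebra all_fingroup all_solvable.
From mathcomp Require Import zify.
Set Implicit Arguments. Unset Strict Implicit. Unset Printing Implicit Defensive.
Import GRing.Theory.

(** A full pattern says that every two-dimensional slice of rho is rectangular.

    Let beta be the key tuple, which may be assumed essential. Among the unary vector-functions
    preserving rho and fixing beta, take a retraction with the smallest images and restrict rho
    to its image, the core. There a vector-function preserving rho that does not send beta into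
    rho is injective. Applied to polynomials of the WNU and combined with rectangularity, this
    yields, for every neighbour o of beta in rho, a binary polymorphism of the core with
    two-sided unit o. The corresponding translations are automorphisms acting transitively
    enough to show that the block of beta in the core is a box on which rho is a Latin
    hypercube; an Eckmann-Hilton argument makes the binary polymorphism an abelian group
    operation, and rho becomes "the sum is 0".

    Given any block of rho, the vector-functions sending it into the block of beta separate
    tuples outside rho from rho, so on and next to the block rho is defined by an equation
    sum_i h_i(x_i) = 0 in a power of that group (scaled so that it becomes a p-group). Modulo h
    the WNU is additive on lines, so iterating it completes squares inside the block; hence the
    block is a box, and then the images of the h_i are cosets of one common subgroup. *)

(** * Finite abelian groups and iterates of a self-map *)

Lemma finZmod_of (T : finType) (add : T -> T -> T) (zero : T) (opp : T -> T) :
  associative add -> commutative add -> left_id zero add -> left_inverse zero opp add ->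
  exists (G : finZmodType) (to : T -> G),
    [/\ bijective to, {morph to : x y / add x y >-> (x + y)%R} & to zero = 0%R].
Proof.
move=> addA addC add0 addN.
pose M := GRing.isZmodule.Build T addA addC add0 addN.
pose G : finZmodType := HB.pack T M.
exists G, (fun x => x); split=> //; exact: (Bijective (g := id)).
Qed.

Lemma card_pexp (G : finZmodType) (p N : nat) :
  prime p -> (forall x : G, x *+ (p ^ N) = 0)%R -> exists k, #|G| = (p ^ k)%N.
Proof.
move=> p_pr killed.
have : (p.-group [set: G])%g.
  rewrite -pnat_exponent; apply: (@pnat_dvd _ (p ^ N)); last by rewrite pnatX pnat_id.
  by apply/exponentP=> x _; rewrite FinRing.zmodXgE; exact: killed.
rewrite /pgroup cardsT => /p_natP[k Gk].
by exists k.
Qed.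

(** The factorial is at least every preperiod and a multiple of every period of a self-map of [A],
    so the [N]-th iterate is idempotent. *)
Lemma iter_fact (A : finType) (g : A -> A) x :
  let N := #|A|`! in iter (N + N) g x = iter N g x.
Proof.
move=> N.
have /trajectP[i lti Ei] := looping_order g x.
have leA : fingraph.order g x <= #|A| by exact: max_card.
set c := fingraph.order g x - i.
have per k : i <= k -> iter (k + c) g x = iter k g x.
  move=> ik; rewrite -{1}(subnK ik) -addnA iterD /c subnKC 1?ltnW // Ei -iterD subnK //.
have per2 q k : i <= k -> iter (k + q * c) g x = iter k g x.
  move=> ik; elim: q => [|q IH]; first by rewrite mul0n addn0.
  by rewrite mulSn (addnC c) addnA per ?IH // (leq_trans ik) ?leq_addr.
have c0 : 0 < c by rewrite subn_gt0.
have /dvdnP[q Nq] : c %| N by rewrite dvdn_fact // c0 (leq_trans (leq_subr _ _)).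
have iN : i <= N.
  apply: leq_trans (ltnW lti) _; apply: leq_trans leA _.
  by rewrite /N; case: #|A| => // a; rewrite factS leq_pmulr // fact_gt0.
by rewrite {2}Nq per2.
Qed.

(** * Coordinate updates, boxes and rectangularity *)

Section Updates.
Variables (A : finType) (n : nat).
Implicit Types (a b : tup A n) (i j : 'I_n) (Psi : 'I_n -> A -> A) (C : 'I_n -> {set A}).

Lemma upd_eq (I : finType) (a : {ffun I -> A}) (i : I) x : upd a i x i = x.
Proof. by rewrite ffunE eqxx. Qed.

Lemma upd_neq (I : finType) (a : {ffun I -> A}) (i : I) x (j : I) : j != i -> upd a i x j = a j.
Proof. by rewrite ffunE => /negPf->. Qed.

Lemma upd_id (I : finType) (a : {ffun I -> A}) (i : I) : upd a i (a i) = a.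
Proof. by apply/ffunP=> j; rewrite ffunE; case: eqP => // ->. Qed.

Lemma upd_upd a i x y : upd (upd a i x) i y = upd a i y.
Proof. by apply/ffunP=> j; rewrite !ffunE; case: eqP. Qed.

Lemma updC a i j x y : i != j -> upd (upd a i x) j y = upd (upd a j y) i x.
Proof.
move=> ij; apply/ffunP=> l; rewrite !ffunE.
by case: (eqVneq l j) => // ->; rewrite eq_sym (negPf ij).
Qed.

Lemma vapply_upd Psi a i x : vapply Psi (upd a i x) = upd (vapply Psi a) i (Psi i x).
Proof. by apply/ffunP=> j; rewrite !ffunE; case: eqP => // ->. Qed.

Lemma boxP C a : reflect (forall i, a i \in C i) (a \in box C).
Proof. by rewrite inE; apply: forallP. Qed.

Lemma box_upd C a i x : a \in box C -> x \in C i -> upd a i x \in box C.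
Proof.
move=> /boxP aC xC; apply/boxP=> j; rewrite ffunE.
by case: (eqVneq j i) => // ->.
Qed.

Definition maps_in C Psi := forall i x, x \in C i -> Psi i x \in C i.

Lemma box_vapply C Psi a : maps_in C Psi -> a \in box C -> vapply Psi a \in box C.
Proof. by move=> PC /boxP aC; apply/boxP=> i; rewrite ffunE; apply: PC. Qed.

Definition vop (op : 'I_n -> A -> A -> A) a b : tup A n := [ffun i => op i (a i) (b i)].

Definition viter k Psi : 'I_n -> A -> A := fun i => iter k (Psi i).

Lemma vapply_viter k Psi a : vapply (viter k Psi) a = iter k (vapply Psi) a.
Proof.
elim: k a => [|k IH] a; first by apply/ffunP=> i; rewrite ffunE.
by rewrite iterS -IH; apply/ffunP=> i; rewrite !ffunE.
Qed.

Lemma vpreserves_viter k Psi (R : {set tup A n}) : vpreserves Psi R -> vpreserves (viter k Psi) R.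
Proof.
move=> PR a aR; rewrite vapply_viter; elim: k => //= k IH; exact: PR.
Qed.

Lemma maps_in_viter k Psi C : maps_in C Psi -> maps_in C (viter k Psi).
Proof. by move=> PC i x xC; rewrite /viter; elim: k => //= k; apply: PC. Qed.

Definition rectangular (R : {set tup A n}) := forall i j a x x' y y', i != j ->
  upd (upd a i x') j y \in R -> upd (upd a i x) j y' \in R ->
  upd (upd a i x') j y' \in R -> upd (upd a i x) j y \in R.

Lemma full_pattern_rectangular R : full_pattern R -> rectangular R.
Proof.
move=> fp i j a x x' y y' ij H1 H2 H3; apply/negPn/negP=> aR.
apply: (fp i j ij); exists (upd (upd a i x) j y), x', y'.
have ji : j != i by rewrite eq_sym.
have E1 : upd (upd (upd a i x) j y) i x' = upd (upd a i x') j y.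
  by rewrite -updC // upd_upd.
by split; rewrite ?E1 ?upd_upd.
Qed.

End Updates.

(** The factorial iterate is idempotent by [iter_fact] and injective on [D], hence the identity
    there. One iterate fewer therefore inverts [g] on [D]; inverses obtained this way still preserve
    the relation. *)
Lemma iter_inj_id (A : finType) (D : {set A}) (g : A -> A) x :
  (forall y, y \in D -> g y \in D) -> {in D &, injective g} ->
  x \in D -> iter #|A|`! g x = x.
Proof.
move=> gD ginj xD.
have iD k y : y \in D -> iter k g y \in D by elim: k => //= k IH /IH /gD.
have injk k : {in D &, injective (iter k g)}.
  by elim: k => // k IH y z yD zD /= /ginj -/(_ (iD _ _ yD) (iD _ _ zD)) /IH; apply.
apply: (injk #|A|`!) => //; first exact: iD.
by rewrite -iterD iter_fact.
Qed.

Lemma third_ord n (i j : 'I_n) : 2 < n -> exists2 k : 'I_n, k != i & k != j.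
Proof.
move=> n3; have /card_gt0P[k] : 0 < #|~: [set i; j]|.
  have := cardsC [set i; j]; rewrite card_ord cards2.
  by case: (_ != _) => /=; lia.
by rewrite !inE negb_or => /andP[]; exists k.
Qed.

(** * Latin hypercubes with a unital operation *)

Section Latin.
Variables (A : finType) (n : nat) (D : 'I_n -> {set A}) (R : {set tup A n}) (o : tup A n).
Variable op : 'I_n -> A -> A -> A.
Hypothesis oR : o \in R.
Hypothesis oD : o \in box D.
Hypothesis rich : forall a i, a \in box D -> exists2 b, b \in D i & upd a i b \in R.
Hypothesis line_uniq : forall a i b b', a \in box D -> b \in D i -> b' \in D i ->
  upd a i b \in R -> upd a i b' \in R -> b = b'.
Hypothesis opD : forall i x y, x \in D i -> y \in D i -> op i x y \in D i.
Hypothesis opo : forall i x, x \in D i -> op i x (o i) = x.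
Hypothesis oop : forall i x, x \in D i -> op i (o i) x = x.
Hypothesis opR : forall a b, a \in R -> b \in R -> a \in box D -> b \in box D ->
  vop op a b \in R.

Let oDi i : o i \in D i. Proof. exact: boxP. Qed.

Section Three.
Variables i0 i1 i2 : 'I_n.
Hypotheses (i10 : i1 != i0) (i20 : i2 != i0) (i21 : i2 != i1).

Let T x y z : tup A n := upd (upd (upd o i0 x) i1 y) i2 z.

Let T_box x y z : x \in D i0 -> y \in D i1 -> z \in D i2 -> T x y z \in box D.
Proof. by move=> *; do 3!apply: box_upd => //. Qed.

Let vopT x y z x' y' z' : vop op (T x y z) (T x' y' z') =
  T (op i0 x x') (op i1 y y') (op i2 z z').
Proof.
apply/ffunP=> l; rewrite !ffunE.
case: (eqVneq l i2) => [->//|_]; case: (eqVneq l i1) => [->//|_].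
by case: (eqVneq l i0) => [->//|_]; rewrite opo.
Qed.

Let T0E x y z : T x y z = upd (T (o i0) y z) i0 x.
Proof. by rewrite /T (updC _ _ _ i20) (updC _ _ _ i10) upd_upd. Qed.

Let T1E x y z : T x y z = upd (T x (o i1) z) i1 y.
Proof. by rewrite /T (updC _ _ _ i21) upd_upd. Qed.

Let T2E x y z : T x y z = upd (T x y (o i2)) i2 z.
Proof. by rewrite /T upd_upd. Qed.

Let Tu0 x x' y z : x \in D i0 -> x' \in D i0 -> y \in D i1 -> z \in D i2 ->
  T x y z \in R -> T x' y z \in R -> x = x'.
Proof.
move=> xD xD' yD zD; rewrite T0E (T0E x').
by apply: line_uniq => //; apply: T_box.
Qed.

Let lift1 x : x \in D i0 -> exists2 y, y \in D i1 & T x y (o i2) \in R.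
Proof.
move=> xD; have [y yD yR] := rich i1 (T_box xD (oDi i1) (oDi i2)).
by exists y; rewrite // T1E.
Qed.

Let lift2 x y : x \in D i0 -> y \in D i1 -> exists2 z, z \in D i2 & T x y z \in R.
Proof.
move=> xD yD; have [z zD zR] := rich i2 (T_box xD yD (oDi i2)).
by exists z; rewrite // T2E.
Qed.

Let T_add u v y z : u \in D i0 -> v \in D i0 -> y \in D i1 -> z \in D i2 ->
  T u y (o i2) \in R -> T v (o i1) z \in R -> T (op i0 u v) y z \in R.
Proof.
move=> uD vD yD zD uR vR.
have := opR uR vR (T_box uD yD (oDi _)) (T_box vD (oDi _) zD).
by rewrite vopT opo ?oop.
Qed.

(** [u] is compensated at [i1] and [v] at [i2]. Since [o] is a unit, both products have the same
    entries at [i1] and [i2], and uniqueness on the line along [i0] identifies them. *)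
Lemma op_comm u v : u \in D i0 -> v \in D i0 -> op i0 u v = op i0 v u.
Proof.
move=> uD vD; have [y yD yR] := lift1 uD; have [z zD zR] := lift2 vD (oDi i1).
apply: (Tu0 (opD uD vD) (opD vD uD) yD zD); first exact: (T_add uD vD yD zD yR zR).
have := opR zR yR (T_box vD (oDi _) zD) (T_box uD yD (oDi _)).
by rewrite vopT opo ?oop.
Qed.

(** As for commutativity, with [t] compensated at [i1] like [u]. Together with [op_comm] this
    identity gives associativity. *)
Lemma op_perm u v t : u \in D i0 -> v \in D i0 -> t \in D i0 ->
  op i0 (op i0 u v) t = op i0 (op i0 u t) v.
Proof.
move=> uD vD tD; have [y yD yR] := lift1 uD; have [z zD zR] := lift2 vD (oDi i1).
have [c cD cR] := lift1 tD.
apply: (Tu0 (opD (opD uD vD) tD) (opD (opD uD tD) vD) (opD yD cD) zD).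
  have := opR (T_add uD vD yD zD yR zR) cR (T_box (opD uD vD) yD zD) (T_box tD cD (oDi _)).
  by rewrite vopT [op i2 _ _]opo.
apply: (T_add (opD uD tD) vD (opD yD cD) zD _ zR).
have := opR yR cR (T_box uD yD (oDi _)) (T_box tD cD (oDi _)).
by rewrite vopT [op i2 _ _]opo.
Qed.

(** [y] compensates [u], [z] compensates [y], and [v] compensates [z]; then [op i0 u v] and [o i0]
    complete the same line. *)
Lemma op_inv u : u \in D i0 -> exists2 v, v \in D i0 & op i0 v u = o i0.
Proof.
move=> uD; have [y yD yR] := lift1 uD.
have [z zD zR] := lift2 (oDi i0) yD.
have [v vD vR] := rich i0 (T_box (oDi i0) (oDi i1) zD); rewrite -T0E in vR.
exists v => //; rewrite op_comm //.
exact: (Tu0 (opD uD vD) (oDi i0) yD zD (T_add uD vD yD zD yR vR)).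
Qed.

End Three.

Lemma latin_group : 2 < n ->
  exists (G : finZmodType) (phi : 'I_n -> A -> G), forall a, a \in box D ->
    (a \in R) = (\sum_i phi i (a i) == 0)%R.
Proof.
move=> n3; have i0 : 'I_n := Ordinal (ltnW (ltnW n3)).
have [i1 i10 _] := third_ord i0 i0 n3.
have [i2 i20 i21] := third_ord i0 i1 n3.
pose T := {x | x \in D i0}.
pose zero : T := Sub (o i0) (oDi i0).
pose add (x y : T) : T := Sub (op i0 (val x) (val y)) (opD (valP x) (valP y)).
pose opp (x : T) : T := odflt zero [pick y | add y x == zero].
have addC : commutative add.
  by move=> x y; apply: val_inj; apply: (op_comm i10 i20 i21); apply: valP.
have addAC x y z : add (add x y) z = add (add x z) y.
  by apply: val_inj; apply: (op_perm i10 i20 i21); apply: valP.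
have addA : associative add by move=> x y z; rewrite (addC x) addAC (addC y x).
have add0 : left_id zero add by move=> x; apply: val_inj; apply/oop/valP.
have addN : left_inverse zero opp add.
  move=> x; rewrite /opp; case: pickP => [y /eqP//|no].
  have [v vD vx] := op_inv i10 i20 i21 (valP x).
  by have /eqP[] := no (Sub v vD); apply: val_inj.
have [G [to [bij_to toD to0]]] := finZmod_of addA addC add0 addN.
(* [ev a] is the value at [i0] that completes [a] to a member of [R]; the default [zero] never
   occurs for [a] in [box D]. *)
pose ev (a : tup A n) : T := odflt zero [pick y : T | upd a i0 (val y) \in R].
have evP a : a \in box D -> upd a i0 (val (ev a)) \in R.
  move=> aD; rewrite /ev; case: pickP => // no.
  have [b bD bR] := rich i0 aD; have := no (Sub b bD).
  by rewrite /= bR.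
have ev_eq a (y : T) : a \in box D -> upd a i0 (val y) \in R -> ev a = y.
  move=> aD yR; apply: val_inj; apply: (line_uniq (a := a) (i := i0)) => //; try exact: valP.
  exact: evP.
pose kap i x := ev (upd o i x).
(* Membership in [R] means [ev a = a i0], and [ev a] will be the sum of the [kap i (a i)] over
   [i != i0]; hence the minus sign at [i0]. *)
exists G, (fun i x => if i == i0 then - to (insubd zero x) else to (kap i x))%R => a aD.
have aDi i : a i \in D i by exact: boxP.
(* The entries of [a] are restored in [o] one at a time; away from [i0], [op] merges tuples that
   differ from [o] in disjoint places. *)
pose cut (s : seq 'I_n) : tup A n := [ffun l => if l \in s then a l else o l].
have cutD s : cut s \in box D by apply/boxP=> l; rewrite ffunE; case: ifP.
have ev_cut s : uniq s -> i0 \notin s -> to (ev (cut s)) = (\sum_(i <- s) to (kap i (a i)))%R.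
  elim: s => [|j s IH] /=.
    rewrite big_nil -to0 => _ _; congr to; apply: ev_eq => //.
    rewrite (_ : cut _ = o) ?upd_id //.
    by apply/ffunP=> l; rewrite ffunE.
  rewrite inE negb_or => /andP[js us] /andP[i0j i0s].
  rewrite big_cons -IH // -toD; congr to; apply: ev_eq => //.
  have jD : upd o j (a j) \in box D by apply: box_upd.
  have := opR (evP _ jD) (evP _ (cutD s)) (box_upd jD (valP _)) (box_upd (cutD s) (valP _)).
  congr (_ \in R); apply/ffunP=> l; rewrite !ffunE inE.
  case: (eqVneq l i0) => [->//|li0]; case: (eqVneq l j) => [->|lj] /=.
    by rewrite (negPf js) opo.
  by case: ifP => _; rewrite oop.
have -> : (\sum_i (if i == i0 then - to (insubd zero (a i)) else to (kap i (a i))) =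
   to (ev a) - to (insubd zero (a i0)))%R.
  rewrite (bigD1 i0) //= eqxx addrC; congr (_ - _)%R.
  have ev_a : ev a = ev (cut [seq i <- index_enum 'I_n | i != i0]).
    apply: ev_eq => //; have := evP _ (cutD [seq i <- index_enum 'I_n | i != i0]).
    congr (_ \in R); apply/ffunP=> l; rewrite !ffunE; case: (eqVneq l i0) => // li0.
    by rewrite mem_filter li0 mem_index_enum.
  rewrite ev_a ev_cut ?filter_uniq ?index_enum_uniq ?mem_filter ?eqxx //.
  by rewrite big_filter; apply: eq_bigr => i /negPf->.
rewrite subr_eq0 (bij_eq bij_to); apply/idP/idP => [aR|/eqP eva].
  by apply/eqP/ev_eq => //; rewrite insubdK // upd_id.
by have := evP _ aD; rewrite eva insubdK // upd_id.
Qed.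

End Latin.

(** * Unital operations on the core *)

Definition unital (A : finType) n (C : 'I_n -> {set A}) (R : {set tup A n}) (o : tup A n)
    (op : 'I_n -> A -> A -> A) :=
  [/\ forall i x y, x \in C i -> y \in C i -> op i x y \in C i,
      forall a b, a \in R -> b \in R -> vop op a b \in R,
      forall i x, x \in C i -> op i x (o i) = x
    & forall i x, x \in C i -> op i (o i) x = x].

Section Core.
Variables (A : finType) (n : nat) (C : 'I_n -> {set A}) (R : {set tup A n}) (b0 : tup A n).
Hypothesis n3 : 2 < n.
Hypothesis rect : rectangular R.
Hypothesis RC : R \subset box C.
Hypothesis bC : b0 \in box C.
Hypothesis bR : b0 \notin R.
Hypothesis ess : forall i, exists b, upd b0 i b \in R.
Hypothesis core : forall Psi, maps_in C Psi -> vpreserves Psi R -> vapply Psi b0 \notin R ->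
  forall i, {in C i &, injective (Psi i)}.

Let bCi i : b0 i \in C i. Proof. exact: boxP. Qed.

Lemma core_mem a i : a \in R -> a i \in C i.
Proof. by move=> /(subsetP RC) /boxP. Qed.

Section Polynomials.
Variables (m : nat) (F : 'I_n -> {ffun 'I_m -> A} -> A).
Hypothesis m2 : 1 < m.
Hypothesis FC : forall i (w : {ffun 'I_m -> A}), (forall p, w p \in C i) -> F i w \in C i.
Hypothesis Fid : forall i x, x \in C i -> F i [ffun=> x] = x.
Hypothesis Fwnu : forall i x y p q, x \in C i -> y \in C i ->
  F i [ffun r => if r == p then y else x] = F i [ffun r => if r == q then y else x].
Hypothesis FR : forall rows : 'I_m -> tup A n, (forall p, rows p \in R) ->
  [ffun i => F i [ffun p => rows p i]] \in R.

(** Unary polynomials with constants taken from [R] preserve [R], so the rigidity hypothesis [core]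
    applies to them. *)
Definition poly1 q (rows : 'I_m -> tup A n) l x :=
  F l [ffun p => if p == q then x else rows p l].

Lemma poly1_maps_in q rows : (forall p, rows p \in R) -> maps_in C (poly1 q rows).
Proof.
by move=> rR l x xC; apply: FC => p; rewrite ffunE; case: eqP => // _; apply: core_mem.
Qed.

Lemma poly1_pres q rows : (forall p, rows p \in R) -> vpreserves (poly1 q rows) R.
Proof.
move=> rR a aR.
have := FR (rows := fun p => if p == q then a else rows p).
have -> : [ffun i => F i [ffun p => (if p == q then a else rows p) i]] = vapply (poly1 q rows) a.
  apply/ffunP=> i; rewrite !ffunE; congr F; apply/ffunP=> p; rewrite !ffunE.
  by case: eqP.
by apply=> p; case: eqP.
Qed.

Let p0 : 'I_m := Ordinal (ltnW m2).
Let p1 : 'I_m := Ordinal m2.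

Let slot l c x := F l [ffun p => if p == p0 then x else c].

Let slotid l c : c \in C l -> slot l c c = c.
Proof.
move=> cC; rewrite -[RHS](Fid cC); congr F; apply/ffunP=> p; rewrite !ffunE.
by case: ifP.
Qed.

(* Replace the arguments [v] by [b0 i] one at a time: at the first place where the i-th line
   through [b0] leaves [R], the corresponding polynomial does not collapse [b0]. *)
Lemma slot_base_inj i v l : upd b0 i v \in R -> l != i ->
  {in C l &, injective (slot l (b0 l))}.
Proof.
move=> vR li; set o := upd b0 i v.
have PC := poly1_maps_in p0 (fun _ : 'I_m => vR); have PR := poly1_pres p0 (fun _ : 'I_m => vR).
have [PbR|PbR] := boolP (vapply (poly1 p0 (fun=> o)) b0 \in R); last first.
  by move=> x y xC yC E; apply: (core PC PR PbR xC yC); rewrite /poly1 upd_neq.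
have vC : v \in C i by have := core_mem i vR; rewrite upd_eq.
pose w k := F i [ffun p : 'I_m => if p < k then b0 i else v].
have w0 : w 0 = v by rewrite /w -[RHS](Fid vC); congr F; apply/ffunP=> p; rewrite !ffunE.
have w1R : upd b0 i (w 1) \in R.
  move: PbR; congr (_ \in R); apply/ffunP=> j; rewrite !ffunE /poly1.
  case: (eqVneq j i) => [->|ji].
    by congr F; apply/ffunP=> p; rewrite !ffunE eqxx ltnS leqn0.
  by rewrite upd_neq //; exact: slotid.
have wm : upd b0 i (w m) \notin R.
  have -> : w m = b0 i by rewrite /w -[RHS](Fid (bCi i)); congr F; apply/ffunP=> p; rewrite !ffunE ltn_ord.
  by rewrite upd_id.
have exk : exists k, upd b0 i (w k) \notin R by exists m.
(* Indices 0 and 1 stay in [R] and [m] does not, so the first exit has the form [k.+2]. *)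
have := ex_minnP exk; case=> -[|[|k]]; rewrite ?w0 ?w1R ?vR // => wkR minw.
have km : k.+1 < m by exact: minw.
have wk1R : upd b0 i (w k.+1) \in R by apply/negPn/negP => /minw; rewrite ltnn.
have [j ji jl] := third_ord i l n3.
have [c cR] := ess j.
(* The variable sits at argument [k.+1]. At coordinate [i] this polynomial sends [b0 i] to [w k.+2]
   and [v] to [w k.+1]; away from [i] and [j] it fixes [b0]. *)
pose q := Ordinal km; pose rows (p : 'I_m) := if p < k.+1 then upd b0 j c else o.
have rR p : rows p \in R by rewrite /rows; case: ifP.
have QC := poly1_maps_in q rR; have QR := poly1_pres q rR.
have QbR : vapply (poly1 q rows) b0 \notin R.
  (* Otherwise the images of [b0] and [o], with [upd b0 i (w k.+1)], are three corners of a
     rectangle whose fourth corner is the excluded [upd b0 i (w k.+2)]. *)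
  apply/negP=> QbR; have := QR _ vR; rewrite vapply_upd => QoR.
  have wE : vapply (poly1 q rows) b0 i = w k.+2.
    rewrite ffunE; congr F; apply/ffunP=> p; rewrite !ffunE /rows (ltnS p k.+1) (leq_eqVlt p k.+1).
    have -> : (p == q) = (p == k.+1 :> nat) by [].
    by case: ifP => //= _; case: ifP => _; [rewrite upd_neq // eq_sym | rewrite upd_eq].
  have wE' : poly1 q rows i v = w k.+1.
    congr F; apply/ffunP=> p; rewrite !ffunE /rows.
    case: (eqVneq p q) => [->|_] /=; first by rewrite ltnn.
    by case: ifP => // _; [rewrite upd_neq // eq_sym | rewrite upd_eq].
  have QE : vapply (poly1 q rows) b0 = upd (upd b0 i (w k.+2)) j (vapply (poly1 q rows) b0 j).
    apply/ffunP=> r; rewrite [RHS]ffunE; case: (eqVneq r j) => [->//|rj].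
    rewrite [RHS]ffunE; case: (eqVneq r i) => [->|ri]; first by rewrite wE.
    rewrite ffunE /poly1 -[RHS](Fid (bCi r)); congr F; apply/ffunP=> p; rewrite !ffunE /rows.
    by case: ifP => // _; case: ifP => _; rewrite upd_neq.
  have ij : i != j by rewrite eq_sym.
  rewrite wE' QE -updC // upd_upd in QoR.
  rewrite QE in QbR.
  have := @rect i j b0 (w k.+2) (w k.+1) (b0 j) (vapply (poly1 q rows) b0 j) ij.
  have E x : upd (upd b0 i x) j (b0 j) = upd b0 i x.
    by rewrite updC // upd_id.
  by rewrite !E (negPf wkR) => /(_ wk1R QbR QoR).
have inj := core QC QR QbR (i := l).
move=> x y xC yC E; apply: inj => //.
(* At [l] all constants equal [b0 l], and the WNU identity moves the variable from [q] to [p0]. *)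
have rowsE z : z \in C l -> poly1 q rows l z = slot l (b0 l) z.
  move=> zC; rewrite /slot -(Fwnu q p0 (bCi l) zC); congr F; apply/ffunP=> p.
  rewrite !ffunE /rows.
  by case: ifP => // _; case: ifP => _; rewrite upd_neq // eq_sym.
by rewrite !rowsE.
Qed.

(** If the polynomial sent [b0] into [R], rectangularity would put a pair ([v], image of [u]) at
    [i], [j] into [R]. Iterating fixes [v] and, by [slot_base_inj], brings the other entry back to
    [u]; a last rectangle then forces [b0] into [R]. *)
Lemma neighbour_inj i v : upd b0 i v \in R ->
  forall l, {in C l &, injective (slot l (upd b0 i v l))}.
Proof.
move=> vR; set o := upd b0 i v.
have PC := poly1_maps_in p0 (fun _ : 'I_m => vR); have PR := poly1_pres p0 (fun _ : 'I_m => vR).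
apply: (core PC PR); apply/negP=> PbR.
have [j ji _] := third_ord i i n3; have [u uR] := ess j.
have ij : i != j by rewrite eq_sym.
have vC : v \in C i by have := core_mem i vR; rewrite upd_eq.
have uC : u \in C j by have := core_mem j uR; rewrite upd_eq.
have einj : {in C j &, injective (slot j (b0 j))} by apply: slot_base_inj vR _.
have eC x : x \in C j -> slot j (b0 j) x \in C j.
  by move=> xC; apply: FC => p; rewrite ffunE; case: ifP.
pose w := slot i v (b0 i).
have E0 x : upd (upd b0 i x) j (b0 j) = upd b0 i x by rewrite updC // upd_id.
have wR : upd b0 i w \in R.
  move: PbR; congr (_ \in R); apply/ffunP=> r; rewrite !ffunE /poly1 !ffunE.
  by case: (eqVneq r i) => [->//|ri]; exact: slotid.
have wuR : upd (upd b0 i w) j (slot j (b0 j) u) \in R.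
  move: (PR _ uR); congr (_ \in R); apply/ffunP=> r; rewrite !ffunE /poly1 !ffunE.
  case: (eqVneq r j) => [->|rj]; first by rewrite (negPf ji).
  by case: (eqVneq r i) => [->//|ri]; exact: slotid.
have vuR : upd (upd b0 i v) j (slot j (b0 j) u) \in R.
  by apply: (@rect _ _ _ _ w _ (b0 j)) => //; rewrite E0.
have vukR k : upd (upd b0 i v) j (iter k.+1 (slot j (b0 j)) u) \in R.
  elim: k => // k /(PR _); congr (_ \in R); rewrite (iterS k.+1); move: (iter k.+1 _ _) => z.
  apply/ffunP=> r; rewrite !ffunE /poly1 !ffunE.
  case: (eqVneq r j) => [->|rj]; first by rewrite (negPf ji).
  by case: (eqVneq r i) => [->|ri]; exact: slotid.
have := vukR #|A|`!.-1; rewrite prednK ?fact_gt0 // (iter_inj_id eC einj uC) => vuR'.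
have E1 : upd (upd b0 i (b0 i)) j u = upd b0 j u by rewrite upd_id.
have := @rect i j b0 (b0 i) v (b0 j) u ij; rewrite !E0 E1 upd_id.
by move=> /(_ vR uR vuR'); apply/negP.
Qed.

(** With [e x = F(x,o,...,o)] a permutation of [C], the operation is the inverse of [e] applied to
    [F(x,y,o,...,o)]; the WNU identity makes [o] a unit on both sides. *)
Lemma unital_at_neighbour i v : upd b0 i v \in R ->
  exists op, unital C R (upd b0 i v) op.
Proof.
move=> vR; set o := upd b0 i v.
have oC l : o l \in C l by apply: core_mem.
pose e l x := slot l (o l) x.
have eC : maps_in C e by apply: (poly1_maps_in p0 (fun _ : 'I_m => vR)).
have eR : vpreserves e R by apply: (poly1_pres p0 (fun _ : 'I_m => vR)).
have eN l x : x \in C l -> iter #|A|`!.-1 (e l) (e l x) = x.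
  move=> xC; rewrite -iterSr prednK ?fact_gt0 //.
  by apply: (iter_inj_id (D := C l)) => //; [exact: eC | exact: neighbour_inj].
pose g l x y := F l [ffun p => if p == p0 then x else if p == p1 then y else o l].
exists (fun l x y => iter #|A|`!.-1 (e l) (g l x y)); split.
- move=> l x y xC yC; apply: (maps_in_viter _ eC); apply: FC => p; rewrite ffunE.
  by case: ifP => // _; case: ifP.
- move=> a b aR bR'.
  have -> : vop (fun l x y => iter #|A|`!.-1 (e l) (g l x y)) a b =
      vapply (viter #|A|`!.-1 e) (vop g a b) by apply/ffunP=> l; rewrite !ffunE.
  apply: vpreserves_viter => //.
  have := FR (rows := fun p => if p == p0 then a else if p == p1 then b else o).
  have -> : [ffun i => F i [ffun p => (if p == p0 then a else if p == p1 then b else o) i]] = vop g a b.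
    apply/ffunP=> r; rewrite [LHS]ffunE [RHS]ffunE; congr F; apply/ffunP=> p; rewrite [LHS]ffunE [RHS]ffunE.
    by do 2!case: ifP => // _.
  by apply=> p; do 2!case: ifP => // _.
- move=> l x xC; rewrite -[RHS](eN l) //; congr iter; congr F; apply/ffunP=> p; rewrite !ffunE.
  by do 2!case: ifP => // _.
move=> l x xC; rewrite -[RHS](eN l) //; congr iter; rewrite /e /slot (Fwnu p0 p1) //.
congr F; apply/ffunP=> p; rewrite [LHS]ffunE [RHS]ffunE.
by case: (eqVneq p p0) => // ->.
Qed.

End Polynomials.

End Core.

(** * Translations of the core *)

Section CoreTranslations.
Variables (A : finType) (n : nat) (C : 'I_n -> {set A}) (R : {set tup A n}) (b0 : tup A n).
Hypothesis n3 : 2 < n.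
Hypothesis rect : rectangular R.
Hypothesis RC : R \subset box C.
Hypothesis bC : b0 \in box C.
Hypothesis bR : b0 \notin R.
Hypothesis ess : forall i, exists b, upd b0 i b \in R.
Hypothesis core : forall Psi, maps_in C Psi -> vpreserves Psi R -> vapply Psi b0 \notin R ->
  forall i, {in C i &, injective (Psi i)}.
Hypothesis unital_nb : forall i v, upd b0 i v \in R -> exists op, unital C R (upd b0 i v) op.

Let bCi i : b0 i \in C i. Proof. exact: boxP. Qed.
Let RCi a i : a \in R -> a i \in C i. Proof. exact: core_mem RC _ _. Qed.

(** The map merging [v] into [v'] at [i] preserves [R]: on tuples with entry [v] it is the product
    by [upd b0 i v'], and [upd b0 i v] is the unit. It fixes [b0], so it must be injective. *)
Lemma base_line_uniq i v v' : upd b0 i v \in R -> upd b0 i v' \in R -> v = v'.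
Proof.
move=> vR v'R; have [op [opC opR opo oop]] := unital_nb vR.
have vC : v \in C i by have := RCi i vR; rewrite upd_eq.
have v'C : v' \in C i by have := RCi i v'R; rewrite upd_eq.
pose Psi l x := if (l == i) && (x == v) then v' else x.
have PC : maps_in C Psi.
  by move=> l x xC; rewrite /Psi; case: ifP => // /andP[/eqP->].
have PR : vpreserves Psi R.
  move=> d dR; case: (eqVneq (d i) v) => [div|div]; last first.
    suff -> : vapply Psi d = d by [].
    apply/ffunP=> l; rewrite ffunE /Psi; case: (eqVneq l i) => //= ->.
    by rewrite (negPf div).
  have := opR _ _ v'R dR; congr (_ \in R); apply/ffunP=> l; rewrite [LHS]ffunE [RHS]ffunE.
  rewrite /Psi; case: (eqVneq l i) => [->|li] /=.
    by rewrite upd_eq div eqxx; have := opo _ _ v'C; rewrite upd_eq.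
  by have := oop l (d l) (RCi l dR); rewrite !upd_neq.
have Pb : vapply Psi b0 = b0.
  apply/ffunP=> l; rewrite ffunE /Psi; case: (eqVneq l i) => //= ->.
  by case: eqP => // E; move: vR; rewrite -E upd_id (negPf bR).
have := core PC PR _ vC v'C; rewrite Pb => /(_ bR); apply.
by rewrite /Psi eqxx eqxx /=; case: ifP.
Qed.

Section ThreeCoordinates.
Variables i j k : 'I_n.
Hypotheses (ij : i != j) (ik : i != k) (jk : j != k).

Variable W : A -> A -> A -> tup A n.
Hypothesis WE : forall x y z, W x y z = upd (upd (upd b0 i x) j y) k z.

Let WE_ij x y z : W x y z = upd (upd (upd b0 k z) i x) j y.
Proof. by rewrite !WE (updC _ _ _ jk) (updC _ _ _ ik). Qed.

Let WE_ik x y z : W x y z = upd (upd (upd b0 j y) i x) k z.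
Proof. by rewrite !WE (updC _ _ _ ij). Qed.

Let rect_ij x x' y y' z : W x' y z \in R -> W x y' z \in R -> W x' y' z \in R -> W x y z \in R.
Proof. by rewrite !WE_ij; apply: rect. Qed.

Let rect_ik x x' y z z' : W x' y z \in R -> W x y z' \in R -> W x' y z' \in R -> W x y z \in R.
Proof. by rewrite !WE_ik; apply: rect. Qed.

Let Wi x y z : W x y z i = x. Proof. by rewrite !WE upd_neq // upd_neq // upd_eq. Qed.
Let Wj x y z : W x y z j = y. Proof. by rewrite !WE upd_neq // upd_eq. Qed.
Let Wk x y z : W x y z k = z. Proof. by rewrite !WE upd_eq. Qed.

Let W_i x : W x (b0 j) (b0 k) = upd b0 i x.
Proof. by rewrite WE_ij upd_id (_ : b0 j = upd b0 i x j) ?upd_id // upd_neq // eq_sym. Qed.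
Let W_k x : W (b0 i) (b0 j) x = upd b0 k x.
Proof. by rewrite !WE !upd_id. Qed.

(* If the translation collapsed [b0], then v ~ b0 i could be carried along the iterated
   translation to a line through a neighbour of [b0]. *)
Lemma translation_inj c z s u op : W (b0 i) c z \in R -> W s (b0 j) z \in R ->
  upd b0 k u \in R -> unital C R (upd b0 k u) op ->
  forall l, {in C l &, injective (fun x => op l x (W (b0 i) c z l))}.
Proof.
move=> cR sR uR [opC opR opo oop].
set g := W (b0 i) c z.
have PC : maps_in C (fun l x => op l x (g l)) by move=> l x xC; apply: opC => //; apply: RCi.
have PE a : vapply (fun l x => op l x (g l)) a = vop op a g by apply/ffunP=> l; rewrite !ffunE.
have PR : vpreserves (fun l x => op l x (g l)) R by move=> a aR; rewrite PE; apply: opR.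
apply: (core PC PR); rewrite PE; apply/negP=> bgR.
have opb l x : l != k -> x \in C l -> op l x (b0 l) = x.
  by move=> lk xC; have := opo l x xC; rewrite upd_neq.
have vopW x y t x' y' t' : vop op (W x y t) (W x' y' t') = W (op i x x') (op j y y') (op k t t').
  apply/ffunP=> l; rewrite [LHS]ffunE !WE [RHS]ffunE; case: (eqVneq l k) => [->|lk]; first by rewrite -!WE !Wk.
  rewrite [RHS]ffunE; case: (eqVneq l j) => [->|lj]; first by rewrite -!WE !Wj.
  rewrite [RHS]ffunE; case: (eqVneq l i) => [->|li]; first by rewrite -!WE !Wi.
  by rewrite !upd_neq // opb.
(* Products with the two given members of [R] act by ([ka], [ta]) on [j], [k] and by ([sg], [ta]) on
   [i], [k]. *)
pose sg x := op i x s; pose ka y := op j y c; pose ta t := op k t z.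
have HI r x y t : W x y t \in R -> W x (iter r ka y) (iter r ta t) \in R.
  elim: r => // r IH /IH H /=; have := opR _ _ H cR.
  by rewrite vopW opb //; have := RCi i H; rewrite Wi.
have HII r x y t : W x y t \in R -> W (iter r sg x) y (iter r ta t) \in R.
  elim: r => // r IH /IH H /=; have := opR _ _ H sR.
  by rewrite vopW (opb j) //; have := RCi j H; rewrite Wj.
have [v vR] := ess i; rewrite -W_i in vR; rewrite -W_k in uR.
have kab : ka (b0 j) = c.
  have cC : c \in C j by have := RCi j cR; rewrite Wj.
  by have := oop j c cC; rewrite upd_neq.
have tau : ta u = z.
  have zC : z \in C k by have := RCi k cR; rewrite Wk.
  by have := oop k z zC; rewrite upd_eq.
have bgE : vop op b0 g = W (b0 i) c (ta (b0 k)).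
  have bE : W (b0 i) (b0 j) (b0 k) = b0 by rewrite W_k upd_id.
  by rewrite -[X in vop op X _]bE vopW opb // [op j _ _]kab.
rewrite bgE in bgR.
have vcR : W v c (ta (b0 k)) \in R by have := HI 1 _ _ _ vR; rewrite /= kab.
have vczR : W v c z \in R by apply: (rect_ik (x' := b0 i) (z' := ta (b0 k))).
(* After [N] steps the entry at [k] is unchanged by [N] more, so the moves along [j] and along [i]
   meet at the same entry. Rectangles then restore [b0] at [i] and [j], and finally at [k]. *)
set N := #|A|`!.
have NE : N = N.-1.+1 by rewrite prednK // fact_gt0.
have vKZ : W v (iter N ka (b0 j)) (iter N ta u) \in R.
  by have := HI N.-1 _ _ _ vczR; rewrite -kab -tau -!iterSr -NE.
have bKZ := HI N _ _ _ uR; have sZ := HII N _ _ _ uR.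
have sKZ := HII N _ _ _ bKZ; rewrite -iterD iter_fact in sKZ.
have bbZ := rect_ij sZ bKZ sKZ.
have vbZ := rect_ij bbZ vKZ bKZ.
by have := rect_ik vR bbZ vbZ; rewrite W_k upd_id; apply/negP.
Qed.

End ThreeCoordinates.

Definition automorphism (T : 'I_n -> A -> A) :=
  [/\ maps_in C T, vpreserves T R & forall i, {in C i &, injective (T i)}].

Lemma automorphism_comp S T : automorphism S -> automorphism T ->
  automorphism (fun i x => S i (T i x)).
Proof.
move=> [SC SR Si] [TC TR Ti]; split=> [i x xC|a aR|i x y xC yC E].
- exact/SC/TC.
- have -> : vapply (fun i x => S i (T i x)) a = vapply S (vapply T a).
    by apply/ffunP=> l; rewrite !ffunE.
  exact/SR/TR.
by apply: (Ti i) => //; apply: (Si i) => //; apply: TC.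
Qed.

Lemma automorphism_inv T : automorphism T -> exists2 S, automorphism S &
  forall i x, x \in C i -> S i (T i x) = x /\ T i (S i x) = x.
Proof.
move=> [TC TR Ti]; have N0 : 0 < #|A|`! by exact: fact_gt0.
have TN i x : x \in C i -> iter #|A|`! (T i) x = x.
  by move=> xC; apply: (iter_inj_id (D := C i)) => //; apply: TC.
have ST i x : x \in C i -> viter #|A|`!.-1 T i (T i x) = x.
  by move=> xC; rewrite /viter -iterSr prednK // TN.
have TS i x : x \in C i -> T i (viter #|A|`!.-1 T i x) = x.
  by move=> xC; rewrite /viter -iterS prednK // TN.
exists (viter #|A|`!.-1 T); last by move=> i x xC; rewrite ST ?TS.
split; [exact: maps_in_viter | exact: vpreserves_viter |].
by move=> i x y xC yC E; rewrite -(TS i x xC) E TS.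
Qed.

(** The future [i]-th side of the block of [b0]: with [ess] covering coordinate [i], the condition
    places [upd b0 i c] in the [rho_tilde] of [R]. *)
Definition reach i : {set A} :=
  [set c in C i | [forall k, (k != i) ==> [exists y, upd (upd b0 i c) k y \in R]]].

Lemma reachP i c : reflect (c \in C i /\ forall k, k != i -> exists y, upd (upd b0 i c) k y \in R)
  (c \in reach i).
Proof.
rewrite inE; apply: (iffP andP) => -[cC H]; split=> //.
  by move=> k ki; have /implyP/(_ ki)/existsP := forallP H k.
by apply/forallP=> k; apply/implyP=> ki; apply/existsP; apply: H.
Qed.

Lemma base_reach i : b0 i \in reach i.
Proof. by apply/reachP; split=> // k _; rewrite upd_id. Qed.

(** The shift is the product by a member of [R] that has [c] at [j], a compensating entry at [k],
    and agrees with [b0] elsewhere. The unit has [u] at [j], so [u] goes to [c]. *)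
Lemma shift_from_neighbour j k u c : j != k -> upd b0 j u \in R -> c \in reach j ->
  exists T, [/\ automorphism T, T j u = c &
    forall l x, l != j -> l != k -> x \in C l -> T l x = x].
Proof.
move=> jk uR /reachP[cC creach]; have kj : k != j by rewrite eq_sym.
have [i ij ik] := third_ord j k n3.
have [z zR] := creach k kj; have [q qR] := creach i ij.
have [op un] := unital_nb uR; have [opC opR opo oop] := un.
pose g := upd (upd (upd b0 i (b0 i)) k z) j c.
have gR : g \in R by rewrite /g upd_id updC // eq_sym.
have qR' : upd (upd (upd b0 i q) k (b0 k)) j c \in R.
  have -> : upd (upd b0 i q) k (b0 k) = upd b0 i q by rewrite updC // upd_id.
  by rewrite updC // eq_sym.
exists (fun l x => op l x (g l)); split.
- split=> [l x xC|a aR|]; first by apply: opC => //; apply: RCi.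
    have -> : vapply (fun l x => op l x (g l)) a = vop op a g by apply/ffunP=> l; rewrite !ffunE.
    exact: opR.
  exact: (translation_inj ik ij kj (fun _ _ _ => erefl) gR qR' uR un).
- by rewrite /g upd_eq; have := oop j c cC; rewrite upd_eq.
move=> l x lj lk xC; have := opo l x xC.
by rewrite upd_neq // /g upd_id !upd_neq.
Qed.

(** The shift of [u] to [c] follows the inverse of the shift of [u] to [b0 j]. *)
Lemma shift_from_base j k c : j != k -> c \in reach j ->
  exists T, [/\ automorphism T, T j (b0 j) = c &
    forall l x, l != j -> l != k -> x \in C l -> T l x = x].
Proof.
move=> jk cD; have [u uR] := ess j.
have uC : u \in C j by have := RCi j uR; rewrite upd_eq.
have [T [Taut Tu Tid]] := shift_from_neighbour jk uR cD.
have [T0 [T0aut T0u T0id]] := shift_from_neighbour jk uR (base_reach j).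
have [S Saut STK] := automorphism_inv T0aut.
exists (fun l x => T l (S l x)); split; first exact: automorphism_comp.
  by rewrite -T0u (proj1 (STK _ _ uC)).
move=> l x lj lk xC; rewrite -{1}(T0id l x) // (proj1 (STK _ _ xC)); exact: Tid.
Qed.

(** All compensation is collected in [k], so shifts at different places of [s] do not disturb each
    other. *)
Lemma shifts (s : seq 'I_n) k (a : tup A n) : uniq s -> k \notin s -> (forall j, j \in s -> a j \in reach j) ->
  exists T, [/\ automorphism T, (forall j, j \in s -> T j (b0 j) = a j) &
    forall l x, l \notin s -> l != k -> x \in C l -> T l x = x].
Proof.
elim: s => [|j s IH] /=.
  move=> _ _ _; exists (fun _ x => x); split=> //; split=> [//|b bR'|i x y _ _ //].
  by rewrite (_ : vapply _ b = b) //; apply/ffunP=> l; rewrite ffunE.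
move=> /andP[js us]; rewrite inE negb_or => /andP[kj ks] aD.
have [|S [Saut Ss Sid]] := IH us ks; first by move=> l ls; apply: aD; rewrite inE ls orbT.
have jk : j != k by rewrite eq_sym.
have [T [Taut Tj Tid]] := shift_from_base jk (aD j (mem_head _ _)).
exists (fun l x => T l (S l x)); split; first exact: automorphism_comp.
  move=> l; rewrite inE; case: (eqVneq l j) => [-> _|lj /= ls]; first by rewrite Sid.
  rewrite Ss // Tid //; first by apply: contraNneq ks => <-.
  by have /reachP[] : a l \in reach l by apply: aD; rewrite inE ls orbT.
move=> l x; rewrite inE negb_or => /andP[lj ls] lk xC.
by rewrite Sid // Tid.
Qed.

Lemma reach_rich a k : a \in box reach -> exists y, upd a k y \in R.
Proof.
move=> /boxP aD; have [u uR] := ess k.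
have := @shifts [seq l <- enum 'I_n | l != k] k a.
rewrite filter_uniq ?enum_uniq // mem_filter eqxx => /(_ isT isT (fun j _ => aD j)).
case=> T [[TC TR _] Ts _]; exists (T k u).
have := TR _ uR; rewrite vapply_upd; congr (_ \in R); apply/ffunP=> l.
rewrite [LHS]ffunE [RHS]ffunE; case: (eqVneq l k) => // lk.
by rewrite ffunE Ts // mem_filter lk mem_enum.
Qed.

Lemma reach_line_uniq a k y y' : a \in box reach ->
  upd a k y \in R -> upd a k y' \in R -> y = y'.
Proof.
move=> /boxP aD yR y'R.
have := @shifts [seq l <- enum 'I_n | l != k] k a.
rewrite filter_uniq ?enum_uniq // mem_filter eqxx => /(_ isT isT (fun j _ => aD j)).
case=> T [Taut Ts _]; have [S [SC SR Si] STK] := automorphism_inv Taut.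
have SE x : vapply S (upd a k x) = upd b0 k (S k x).
  rewrite vapply_upd; apply/ffunP=> l; rewrite [LHS]ffunE [RHS]ffunE; case: (eqVneq l k) => // lk.
  have al : T l (b0 l) = a l by apply: Ts; rewrite mem_filter lk mem_enum.
  by rewrite ffunE -al; have [] := STK _ _ (bCi l).
have := SR _ yR; have := SR _ y'R; rewrite !SE => H H'.
apply: (Si k); last exact: base_line_uniq H' H.
  by have := RCi k yR; rewrite upd_eq.
by have := RCi k y'R; rewrite upd_eq.
Qed.

(** Completability can be tested at any base [a] of the box: an automorphism carries it back to
    [b0]. Leaving [i] unshifted keeps [c] itself, while [k] absorbs the compensation. *)
Lemma reach_closed a i c : a \in box reach ->
  (forall k, k != i -> exists y, upd (upd a i c) k y \in R) -> c \in reach i.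
Proof.
move=> /boxP aD H.
have cC : c \in C i.
  have [k ki _] := third_ord i i n3; have [y yR] := H k ki.
  by have := RCi i yR; rewrite upd_neq ?upd_eq // eq_sym.
apply/reachP; split=> // k ki; have [y yR] := H k ki.
have ik : i != k by rewrite eq_sym.
have := @shifts [seq l <- enum 'I_n | (l != i) && (l != k)] k a.
rewrite filter_uniq ?enum_uniq // mem_filter eqxx andbF => /(_ isT isT (fun j _ => aD j)).
case=> T [Taut Ts Tid]; have [S [SC SR Si] STK] := automorphism_inv Taut.
exists (S k y); have := SR _ yR; rewrite !vapply_upd; congr (_ \in R).
have Sic : S i c = c.
  by rewrite -{1}(Tid i c) ?mem_filter ?eqxx // (proj1 (STK _ _ cC)).
apply/ffunP=> l; rewrite [LHS]ffunE [RHS]ffunE; case: (eqVneq l k) => // lk.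
rewrite [LHS]ffunE [RHS]ffunE; case: (eqVneq l i) => // li.
have al : T l (b0 l) = a l by apply: Ts; rewrite mem_filter li lk mem_enum.
by rewrite ffunE -al; have [] := STK _ _ (bCi l).
Qed.

Lemma core_group : exists (G : finZmodType) (phi : 'I_n -> A -> G), forall a, a \in box reach ->
    (a \in R) = (\sum_i phi i (a i) == 0)%R.
Proof.
have i0 : 'I_n := Ordinal (ltnW (ltnW n3)).
have bD : b0 \in box reach by apply/boxP=> i; apply: base_reach.
have close a i b : a \in box reach -> upd a i b \in R -> b \in reach i.
  move=> aD bR'; apply: (reach_closed aD) => k ki; exists (a k).
  by rewrite (_ : a k = upd a i b k) ?upd_id // upd_neq.
have [u uR] := ess i0; have [op [opC opR opo oop]] := unital_nb uR.
set o := upd b0 i0 u in uR opo oop.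
have oD : o \in box reach by apply: box_upd => //; apply: close uR.
have DC i x : x \in reach i -> x \in C i by case/reachP.
have oC i : o i \in C i by apply: RCi.
apply: (@latin_group _ _ reach R o op) => //.
- move=> a i aD; have [b bR'] := reach_rich i aD; exists b => //; exact: close bR'.
- by move=> a i b b' aD _ _; apply: reach_line_uniq.
(* Multiplying completions of [x] and [y] over the base [o] completes [op i x y]. *)
- move=> i x y xD yD; apply: (reach_closed oD) => k ki.
  have [x' xR] := reach_rich k (box_upd oD xD); have [y' yR] := reach_rich k (box_upd oD yD).
  exists (op k x' y'); have := opR _ _ xR yR; congr (_ \in R).
  apply/ffunP=> l; rewrite [LHS]ffunE [RHS]ffunE; case: (eqVneq l k) => [->|lk].
    by rewrite !upd_eq.
  rewrite [RHS]ffunE; case: (eqVneq l i) => [->|li].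
    have ik : i != k by rewrite eq_sym.
    by rewrite !(upd_neq _ _ ik) !upd_eq.
  by rewrite !(upd_neq _ _ lk) !(upd_neq _ _ li) opo.
- by move=> i x /DC; apply: opo.
- by move=> i x /DC; apply: oop.
by move=> a b aR bR' _ _; apply: opR.
Qed.

End CoreTranslations.

(** * Existence of the core *)

Lemma leq_sum_eq n (F H : 'I_n -> nat) :
  (forall i, F i <= H i) -> \sum_i H i <= \sum_i F i -> forall i, F i = H i.
Proof.
move=> FH HF i; apply/eqP; rewrite eqn_leq FH leqNgt; apply/negP=> lt_i.
move: HF; rewrite (bigD1 i) //= [leqRHS](bigD1 i) //=.
rewrite leqNgt => /negP; apply; rewrite -addSn.
by apply: leq_add => //; apply: leq_sum.
Qed.

Section KeyCore.
Variables (A : finType) (n : nat) (rho : {set tup A n}) (beta : tup A n).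
Hypothesis n3 : 2 < n.
Hypothesis rect : rectangular rho.
Hypothesis betaR : beta \notin rho.
Hypothesis beta_ess : forall i, exists b, upd beta i b \in rho.
Hypothesis key : forall a, a \notin rho -> exists Psi, vpreserves Psi rho /\ vapply Psi a = beta.
Hypothesis wnu : preserved_by_WNU rho.

(** Among the finitely many admissible vector-functions one of least total image size is chosen; its
    idempotent iterate has no larger image. *)
Lemma exists_core_retraction : exists r : 'I_n -> A -> A,
  [/\ vpreserves r rho, vapply r beta = beta, forall i x, r i (r i x) = r i x &
    forall Psi, vpreserves Psi rho -> vapply Psi beta = beta ->
      \sum_i #|[set x | r i x == x]| <= \sum_i #|[set Psi i x | x in A]|].
Proof.
pose S : finType := {ffun 'I_n -> {ffun A -> A}}.
pose fn (P : S) : 'I_n -> A -> A := fun i x => P i x.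
pose E (P : S) := [forall a in rho, vapply (fn P) a \in rho] && (vapply (fn P) beta == beta).
pose mu (P : S) := \sum_i #|[set fn P i x | x in A]|.
have ext (P : S) Psi : (forall i x, P i x = Psi i x) -> vapply (fn P) =1 vapply Psi.
  by move=> H a; apply/ffunP=> i; rewrite !ffunE /fn H.
pose one : S := [ffun _ => [ffun x => x]].
have Eone : E one.
  have one1 a : vapply (fn one) a = a by apply/ffunP=> i; rewrite !ffunE /fn !ffunE.
  by rewrite /E one1 eqxx andbT; apply/forall_inP=> a aR; rewrite one1.
have [P EP minP] := arg_minnP mu Eone.
have [/forall_inP PR /eqP Pb] := andP EP.
have N0 : 0 < #|A|`! by exact: fact_gt0.
exists (viter #|A|`! (fn P)); split.
- exact: vpreserves_viter.
- rewrite vapply_viter; elim: #|A|`! => //= k ->; exact: Pb.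
- by move=> i x; rewrite /viter -iterD iter_fact.
move=> Psi PsiR Psib.
pose Q : S := [ffun i => [ffun x => Psi i x]].
have QE i x : Q i x = Psi i x by rewrite !ffunE.
have EQ : E Q.
  rewrite /E (ext _ _ QE) Psib eqxx andbT; apply/forall_inP=> a aR.
  by rewrite (ext _ _ QE); apply: PsiR.
have -> : \sum_i #|[set Psi i x | x in A]| = mu Q.
  by apply: eq_bigr => i _; congr #|pred_of_set _|; apply: eq_imset => x; rewrite /fn QE.
apply: leq_trans (minP Q EQ); apply: leq_sum => i _; apply/subset_leq_card/subsetP=> x.
rewrite inE => /eqP <-; apply/imsetP; exists (iter #|A|`!.-1 (fn P i) x) => //.
by rewrite /viter -iterS prednK.
Qed.

Lemma key_core : exists (C D : 'I_n -> {set A}) (G : finZmodType) (phi : 'I_n -> A -> G),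
  [/\ beta \in box D,
      forall a, a \notin rho ->
        exists Psi, [/\ vpreserves Psi rho, forall i x, Psi i x \in C i & vapply Psi a = beta],
      forall Psi, vpreserves Psi rho -> (forall i x, Psi i x \in C i) ->
        forall c i x, vapply Psi c \in box D ->
          (forall k, exists y, upd (upd c i x) k y \in rho) -> Psi i x \in D i
    & forall a, a \in box D -> (a \in rho) = (\sum_i phi i (a i) == 0)%R].
Proof.
have [r [rR rb rr rmin]] := exists_core_retraction.
pose C i := [set x | r i x == x]; pose R := rho :&: box C.
have rC i x : r i x \in C i by rewrite inE rr.
have vrC a : vapply r a \in box C by apply/boxP=> i; rewrite ffunE.
have rid i x : x \in C i -> r i x = x by rewrite inE => /eqP.
have bC : beta \in box C by rewrite -rb.
have bR : beta \notin R by rewrite inE negb_and betaR.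
have RC : R \subset box C by exact: subsetIr.
have rectR : rectangular R.
  move=> i j a x x' y y' ij; rewrite !inE => /andP[H1 /forallP C1] /andP[H2 /forallP C2] /andP[H3 _].
  rewrite (rect ij H1 H2 H3); apply/forallP=> l; have := C1 l; have := C2 l.
  rewrite !ffunE; case: (l == j) => //.
have essR i : exists b, upd beta i b \in R.
  have [b bR'] := beta_ess i; exists (r i b); have := rR _ bR'.
  by rewrite vapply_upd rb inE => ->; rewrite box_upd.
have coreR Psi : maps_in C Psi -> vpreserves Psi R -> vapply Psi beta \notin R ->
    forall i, {in C i &, injective (Psi i)}.
  move=> PC PR PbR.
  have Pb_rho : vapply Psi beta \notin rho.
    by apply: contra PbR => H; rewrite inE H; apply: box_vapply.
  have [Q [QR Qb]] := key Pb_rho.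
  (* Precomposing with [r] and returning to [beta] by the key property gives a competitor to [r];
     minimality leaves no room for a collapse on [C i]. *)
  pose Th i x := Q i (Psi i (r i x)).
  have ThE a : vapply Th a = vapply Q (vapply Psi (vapply r a)).
    by apply/ffunP=> i; rewrite !ffunE.
  have ThR : vpreserves Th rho.
    move=> a aR; rewrite ThE; apply: QR.
    have /setIP[] // : vapply Psi (vapply r a) \in R.
    by apply: PR; rewrite inE rR ?vrC.
  have Thb : vapply Th beta = beta by rewrite ThE rb.
  have ThC i : [set Th i x | x in A] = [set Q i (Psi i x) | x in C i].
    apply/setP=> y; apply/imsetP/imsetP=> -[x xA ->]; last by exists x; rewrite // /Th rid.
    by exists (r i x).
  have card_eq := @leq_sum_eq n (fun i => #|[set Th i x | x in A]|) (fun i => #|C i|) _ (rmin _ ThR Thb).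
  have {}card_eq i : #|[set Q i (Psi i x) | x in C i]| == #|C i|.
    by rewrite -ThC card_eq // => j; rewrite ThC leq_imset_card.
  move=> i x y xC yC E; have /imset_injP inj := card_eq i.
  by apply: inj => //; rewrite E.
have [m [f [[m2 [fid fw]] fR]]] := wnu.
(* Following the WNU by [r] brings its values back to the core and keeps its identities there. *)
pose F i (w : {ffun 'I_m -> A}) := r i (f w).
have unit i v : upd beta i v \in R -> exists op, unital C R (upd beta i v) op.
  apply: (@unital_at_neighbour _ _ C R beta n3 rectR RC bC bR essR coreR m F m2).
  - by move=> l w _; apply: rC.
  - by move=> l x xC; rewrite /F fid rid.
  - move=> l x y p q _ _; rewrite /F.
    have E (s : 'I_m) : [ffun t => if t == s then y else x] = upd [ffun=> x] s y.
      by apply/ffunP=> t; rewrite !ffunE.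
    by rewrite !E (fw x y p q).
  - move=> rows rowsR.
    have H : [ffun l => f [ffun p => rows p l]] \in rho.
      by apply: fR => p; have := rowsR p; rewrite inE => /andP[].
    have := rR _ H; have := vrC [ffun l => f [ffun p => rows p l]].
    have -> : vapply r [ffun l => f [ffun p => rows p l]] = [ffun l => F l [ffun p => rows p l]].
      by apply/ffunP=> l; rewrite !ffunE.
    by rewrite [in X in _ -> _ -> X]inE => -> ->.
have [G [phi phiP]] := core_group n3 rectR RC bC bR essR coreR unit.
have DC a : a \in box (reach C R beta) -> a \in box C.
  by move=> /boxP aD; apply/boxP=> i; have /reachP[] := aD i.
exists C, (reach C R beta), G, phi; split.
- by apply/boxP=> i; apply: (base_reach bC).
- move=> a aR; have [Psi [PR Pa]] := key aR.
  exists (fun i x => r i (Psi i x)); split=> //.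
    move=> b bR'; have := rR _ (PR _ bR').
    by congr (_ \in rho); apply/ffunP=> i; rewrite !ffunE.
  by rewrite -rb -Pa; apply/ffunP=> i; rewrite !ffunE.
- move=> Psi PR PC c i x cD H.
  apply: (reach_closed n3 rectR RC bC bR essR coreR unit cD) => k ki.
  have [y yR] := H k; exists (Psi k y).
  have := PR _ yR; rewrite !vapply_upd inE => ->.
  by do 2!apply: box_upd => //; apply: DC.
by move=> a aD; rewrite -phiP // inE (DC a aD) andbT.
Qed.

End KeyCore.

(** * Blocks *)

Section Blocks.
Variables (A : finType) (n : nat) (rho : {set tup A n}).
Implicit Types a b c d : tup A n.

Lemma rho_tildeP a : reflect (forall i, exists x, upd a i x \in rho) (a \in rho_tilde rho).
Proof.
rewrite inE; apply: (iffP orP) => [[aR i|/forallP H i]|H].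
- by exists (a i); rewrite upd_id.
- exact/existsP.
by right; apply/forallP=> i; apply/existsP.
Qed.

Lemma rho_sub_tilde a : a \in rho -> a \in rho_tilde rho.
Proof. by rewrite inE => ->. Qed.

Lemma adjP a b : reflect (exists2 i, a i != b i & b = upd a i (b i)) (adj a b).
Proof.
apply: (iffP cards1P) => [[i /setP H]|[i abi E]]; exists i.
- by have := H i; rewrite !inE eqxx.
- apply/ffunP=> j; rewrite ffunE; case: (eqVneq j i) => [->//|ji].
  by have := H j; rewrite !inE (negPf ji) => /negbFE/eqP.
apply/setP=> j; rewrite !inE; case: (eqVneq j i) => [->//|ji].
by rewrite E upd_neq // eqxx.
Qed.

Lemma adj_sym a b : adj a b = adj b a.
Proof. by rewrite /adj; congr (_ == _); apply: eq_card => i; rewrite !inE eq_sym. Qed.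

Lemma tilde_connect_sym : connect_sym (tilde_edge rho).
Proof. by apply: sym_connect_sym => a b; rewrite /tilde_edge adj_sym andbCA. Qed.

Variable Bk : {set tup A n}.
Hypothesis blk : is_block rho Bk.

Lemma block_tilde c : c \in Bk -> c \in rho_tilde rho.
Proof. by have [a _ ->] := blk; rewrite inE => /andP[]. Qed.

Lemma block_step c i x : c \in Bk -> upd c i x \in rho_tilde rho -> upd c i x \in Bk.
Proof.
move=> cB ut; move: cB; have [a _ ->] := blk.
rewrite in_set => /andP[ct ac]; rewrite in_set ut /=.
case: (eqVneq (c i) x) => [<-|cx]; first by rewrite upd_id.
apply: connect_trans ac _; apply: connect1; rewrite /tilde_edge ct ut.
by apply/adjP; exists i; rewrite upd_eq.
Qed.

Lemma block_ind (P : tup A n -> Prop) c : c \in Bk -> P c ->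
  (forall d i x, d \in Bk -> P d -> upd d i x \in Bk -> P (upd d i x)) ->
  forall d, d \in Bk -> P d.
Proof.
move=> cB Pc step d dB.
have cd : connect (tilde_edge rho) c d.
  move: cB dB; have [a _ ->] := blk; rewrite !in_set => /andP[_ ac] /andP[_ ad].
  by apply: connect_trans ad; rewrite tilde_connect_sym.
have /connectP[s ps ->] := cd; elim: s c cB Pc ps {cd} => //= e s IH c cB Pc /andP[/and3P[_ et ce] ps].
have [i _ E] := adjP _ _ ce; apply: IH => //.
  by rewrite E; apply: block_step => //; rewrite -E.
by rewrite E; apply: step => //; apply: block_step => //; rewrite -E.
Qed.

Lemma block_nonempty : exists a, a \in Bk.
Proof. by have [a at_ ->] := blk; exists a; rewrite in_set at_ connect0. Qed.

(** Along a path from [s] to [t], replacing the [i]-th entry by [s i] stays in the block, each step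
    being one filled square. Thus entries of block tuples combine freely. *)
Lemma block_box :
  (forall a i j x y, i != j -> a \in Bk -> upd a i x \in Bk -> upd a j y \in Bk ->
     upd (upd a i x) j y \in rho_tilde rho) ->
  exists Bs : 'I_n -> {set A}, Bk = box Bs.
Proof.
move=> square.
have exch s t i : s \in Bk -> t \in Bk -> upd t i (s i) \in Bk.
  move=> sB tB; apply: (block_ind (P := fun t => upd t i (s i) \in Bk) sB) tB; first by rewrite upd_id.
  move=> d j y dB Pd uB; case: (eqVneq j i) => [->|ji]; first by rewrite upd_upd.
  by apply: block_step => //; apply: square.
exists (fun i => [set c i | c : tup A n in Bk]); apply/setP=> a; apply/idP/boxP => [aB i|aBs].
  by apply/imsetP; exists a.
have [t tB] := block_nonempty.
have H (s : seq 'I_n) : [ffun l => if l \in s then a l else t l] \in Bk.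
  elim: s => [|i s IH].
    by rewrite (_ : [ffun _ => _] = t) //; apply/ffunP=> l; rewrite ffunE.
  have /imsetP[c cB ai] := aBs i.
  have := exch _ _ i cB IH; congr (_ \in Bk); apply/ffunP=> l; rewrite !ffunE inE -ai.
  by case: (eqVneq l i) => [->|].
have := H (enum 'I_n); congr (_ \in Bk); apply/ffunP=> l.
by rewrite ffunE mem_enum.
Qed.

Variables (m : nat) (f : {ffun 'I_m -> A} -> A).
Hypothesis fid : forall x, f [ffun=> x] = x.
Hypothesis fR : fpreserves f rho.

Definition vf (rows : 'I_m -> tup A n) : tup A n := [ffun i => f [ffun k => rows k i]].

Lemma vf_tilde rows : (forall p, rows p \in rho_tilde rho) -> vf rows \in rho_tilde rho.
Proof.
move=> rt; apply/rho_tildeP=> i.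
have [b bR] := fin_all_exists (fun p => rho_tildeP _ (rt p) i).
exists (f [ffun p => b p]); have := fR bR; congr (_ \in rho); apply/ffunP=> l; rewrite !ffunE.
by case: (eqVneq l i) => [->|li]; congr f; apply/ffunP=> p; rewrite !ffunE ?eqxx ?(negPf li).
Qed.

(** The arguments are changed from a constant [c0] to [rows] one at a time, each along a path in the
    block; every step alters one coordinate of the value. *)
Lemma vf_block rows : (forall p, rows p \in Bk) -> vf rows \in Bk.
Proof.
move=> rB; have [c0 c0B] := block_nonempty.
have H q : vf (fun p => if p < q then rows p else c0) \in Bk.
  elim: q => [|q IH].
    by rewrite (_ : vf _ = c0) //; apply/ffunP=> i; rewrite ffunE /= fid.
  have [qm|mq] := ltnP q m; last first.
    move: IH; congr (_ \in Bk); apply/ffunP=> i; rewrite !ffunE; congr f; apply/ffunP=> p.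
    by rewrite !ffunE (leq_trans (ltn_ord p) mq) (leq_trans (ltn_ord p) (leqW mq)).
  pose rw d (p : 'I_m) := if p == q :> nat then d else if p < q then rows p else c0.
  have rwB d p : d \in Bk -> rw d p \in Bk by move=> dB; rewrite /rw; do 2!case: ifP => // _.
  have -> : vf (fun p => if p < q.+1 then rows p else c0) = vf (rw (rows (Ordinal qm))).
    apply/ffunP=> i; rewrite !ffunE; congr f; apply/ffunP=> p; rewrite !ffunE /rw ltnS leq_eqVlt.
    by case: eqVneq => //= pq; congr (rows _ i); apply: val_inj.
  apply: (block_ind (P := fun d => vf (rw d) \in Bk) c0B _ _ (rB _)).
    move: IH; congr (_ \in Bk); apply/ffunP=> i; rewrite !ffunE; congr f; apply/ffunP=> p.
    by rewrite !ffunE /rw; case: eqVneq => // ->; rewrite ltnn.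
  move=> d i x dB Pd uB.
  have E : vf (rw (upd d i x)) = upd (vf (rw d)) i (vf (rw (upd d i x)) i).
    apply/ffunP=> l; rewrite [RHS]ffunE; case: (eqVneq l i) => [->//|li].
    rewrite !ffunE; congr f; apply/ffunP=> p; rewrite !ffunE /rw; case: ifP => // _.
    by rewrite upd_neq.
  rewrite E; apply: block_step => //; rewrite -E; apply: vf_tilde => p.
  exact/block_tilde/rwB.
have := H m; congr (_ \in Bk); apply/ffunP=> i; rewrite !ffunE; congr f; apply/ffunP=> p.
by rewrite !ffunE ltn_ord.
Qed.

End Blocks.

(** * Blocks as solution sets *)

(** [p] divides the order of [t], and [r] is the prime-to-[p] part of the order of [G]:
    multiplication by [r] leaves only [p]-torsion and cannot kill [t]. *)
Lemma finZmod_scale (G : finZmodType) (t : G) : (t != 0)%R ->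
  exists p r k, [/\ prime p, (t *+ r != 0)%R & forall x : G, (x *+ r *+ (p ^ k) = 0)%R].
Proof.
move=> t0; pose g := #|G|; pose p := pdiv #[t]%g.
have g0 : 0 < g by apply/card_gt0P; exists t.
have tG : #[t]%g %| g by rewrite /g -cardsT; apply: order_dvdG; rewrite inE.
have p_pr : prime p by rewrite pdiv_prime // order_gt1.
exists p, g`_p^', (logn p g); split=> // [|x].
  apply/negP=> /eqP tr0.
  have : (p %| g`_p^')%N.
    apply: dvdn_trans (pdiv_dvd #[t]%g) _.
    by rewrite order_dvdn FinRing.zmodXgE tr0.
  by apply/negP; rewrite -p'natE // part_pnat.
rewrite -mulrnA -p_part mulnC partnC // /g -cardsT -FinRing.zmodXgE.
by apply/eqP; rewrite -[0%R]/(1%g) -order_dvdn order_dvdG ?inE.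
Qed.

Lemma zmod_swap (H : zmodType) (t u w x x' y y' : H) :
  (t + (x' - u) + (y' - w) = t + (x - u) + (y - w) -> x' - x = y - y')%R.
Proof.
rewrite -2!(addrA t) => /addrI; rewrite !(addrACA _ (- u)%R) => /addIr E.
by apply/eqP; rewrite subr_eq addrAC eq_sym subr_eq addrC E.
Qed.

Section Total.
Variables (A : finType) (n : nat) (H : zmodType) (h : 'I_n -> A -> H).
Local Open Scope ring_scope.

Definition total (a : tup A n) : H := \sum_i h i (a i).

Lemma total_upd a i x : total (upd a i x) = total a + (h i x - h i (a i)).
Proof.
rewrite /total !(bigD1 (P := xpredT) i) //= upd_eq.
rewrite (eq_bigr (fun l => h l (a l))); last by move=> l li; rewrite upd_neq.
by rewrite [in RHS](addrC (h i (a i))) -addrA (addrCA (h i (a i))) subrr addr0 addrC.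
Qed.
End Total.

(** The equation is also required one step beyond the block, for entries that occur in it; this
    allows entries to be exchanged before the block is known to be a box. *)
Definition block_solution A n (rho Bk : {set tup A n}) (H : zmodType) (h : 'I_n -> A -> H) :=
  forall c i x, c \in Bk -> (exists2 c', c' \in Bk & c' i = x) ->
    (upd c i x \in rho) = (total h (upd c i x) == 0)%R.

Section KeyBlocks.
Variables (A : finType) (n : nat) (rho : {set tup A n}) (beta : tup A n).
Hypothesis n3 : 2 < n.
Hypothesis rect : rectangular rho.
Hypothesis betaR : beta \notin rho.
Hypothesis beta_ess : forall i, exists b, upd beta i b \in rho.
Hypothesis key : forall a, a \notin rho -> exists Psi, vpreserves Psi rho /\ vapply Psi a = beta.
Hypothesis wnu : preserved_by_WNU rho.

Lemma block_embedding Bk : is_block rho Bk ->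
  exists (H : zmodType) (h : 'I_n -> A -> H) (p k : nat),
    [/\ prime p, forall i x, (h i x *+ (p ^ k) = 0)%R & block_solution rho Bk h].
Proof.
move=> blk; have [C [D [G [phi [bD sep closed eqn]]]]] := key_core n3 rect betaR beta_ess key wnu.
have t0 : (\sum_i phi i (beta i) != 0)%R by rewrite -eqn.
have [p [r [k [p_pr tr kill]]]] := finZmod_scale t0.
pose S : finType := {ffun 'I_n -> {ffun A -> A}}.
pose fn (P : S) : 'I_n -> A -> A := fun i x => P i x.
pose good (P : S) := [&& [forall a in rho, vapply (fn P) a \in rho],
  [forall i, forall x, fn P i x \in C i] & [forall c in Bk, vapply (fn P) c \in box D]].
(* One component for each vector-function into the core that sends the block into [box D]; all other
   components are zero. *)
pose h i x : {ffun S -> G} := [ffun P : S => if good P then (phi i (fn P i x) *+ r)%R else 0%R].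
have totE d P : good P -> total h d P = ((\sum_i phi i (vapply (fn P) d i)) *+ r)%R.
  move=> gP; rewrite /total sum_ffunE -sumrMnl; apply: eq_bigr => i _.
  by rewrite !ffunE gP.
exists {ffun S -> G}, h, p, k; split=> // [i x|c i x cB [c' c'B c'i]].
  apply/ffunP=> P; rewrite ffunMnE !ffunE; case: ifP => _; last by rewrite mul0rn.
  exact: kill.
set d := upd c i x; apply/idP/eqP => [dR|tot0].
  apply/ffunP=> P; rewrite ffunE; case: (boolP (good P)) => gP; last first.
    rewrite /total sum_ffunE big1 // => l _.
    by rewrite ffunE (negPf gP).
  have /and3P[/forall_inP PR _ /forall_inP PB] := gP.
  have PdD : vapply (fn P) d \in box D.
    apply/boxP=> l; rewrite ffunE /d ffunE; case: (eqVneq l i) => [->|li].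
      by have /boxP/(_ i) := PB _ c'B; rewrite ffunE c'i.
    by have /boxP/(_ l) := PB _ cB; rewrite ffunE.
  by have := PR _ dR; rewrite totE // eqn // => /eqP->; rewrite mul0rn.
(* The map separating [d] sends [c], one step from [d], into [box D]; [closed] spreads this along
   the block, so the map indexes a component where the total is nonzero. *)
apply/negPn/negP=> dR; have [Psi [PR PC Pd]] := sep _ dR.
pose P : S := [ffun i => [ffun x => Psi i x]].
have PE : vapply (fn P) =1 vapply Psi by move=> a; apply/ffunP=> l; rewrite !ffunE /fn !ffunE.
have gP : good P.
  apply/and3P; split.
  - by apply/forall_inP=> a aR; rewrite PE; apply: PR.
  - by apply/forallP=> l; apply/forallP=> y; rewrite /fn !ffunE.
  apply/forall_inP=> a aB; rewrite PE; move: a aB.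
  apply: (block_ind blk cB).
    have cE : c = upd d i (c i) by rewrite /d upd_upd upd_id.
    rewrite cE vapply_upd Pd; apply: box_upd => //.
    apply: (closed _ PR PC d); rewrite ?Pd // -cE.
    exact/rho_tildeP/(block_tilde blk).
  move=> a l y aB aD uB; rewrite vapply_upd; apply: box_upd => //.
  by apply: (closed _ PR PC a) => //; apply/rho_tildeP/(block_tilde blk).
move/ffunP/(_ P): tot0; rewrite totE // PE Pd ffunE => /eqP.
by apply/negP.
Qed.

(** * Completing squares inside a block *)

Section Square.
Variable Bk : {set tup A n}.
Hypothesis blk : is_block rho Bk.
Variables (H : zmodType) (h : 'I_n -> A -> H).
Hypothesis sol : block_solution rho Bk h.
Variables (m : nat) (f : {ffun 'I_m -> A} -> A).
Hypothesis fwnu : is_WNU f.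
Hypothesis fR : fpreserves f rho.

Let m2 : 1 < m. Proof. by case: fwnu. Qed.
Let fid x : f [ffun=> x] = x. Proof. by case: fwnu => _ []. Qed.
Let fw x y (p q : 'I_m) : f [ffun r => if r == p then y else x] = f [ffun r => if r == q then y else x].
Proof.
have E (s : 'I_m) : [ffun r => if r == s then y else x] = upd [ffun=> x] s y.
  by apply/ffunP=> r; rewrite !ffunE.
by rewrite !E; case: fwnu => _ [_]; apply.
Qed.

Let p0 : 'I_m := Ordinal (ltnW m2).
Let p1 : 'I_m := Ordinal m2.
Let e c x := f [ffun p => if p == p0 then x else c].

Lemma block_solution_mem c : c \in Bk -> (c \in rho) = (total h c == 0)%R.
Proof.
move=> cB; have [i0] : exists i : 'I_n, true by exists (Ordinal (ltnW (ltnW n3))).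
by rewrite -{1 2}(upd_id c i0) => _; apply: sol => //; exists c.
Qed.

Let total0 c : c \in rho -> c \in Bk -> total h c = 0%R.
Proof. by move=> cR cB; apply/eqP; rewrite -block_solution_mem. Qed.

Let fill c i : c \in Bk -> exists2 b, upd c i b \in rho & upd c i b \in Bk.
Proof.
move=> cB; have [b bR] := rho_tildeP _ _ (block_tilde blk cB) i.
by exists b => //; apply: (block_step blk) => //; apply: rho_sub_tilde.
Qed.

Let vf_mem rows : (forall p, rows p \in rho) -> (forall p, rows p \in Bk) -> total h (vf f rows) = 0%R.
Proof. by move=> rR rB; apply: total0; [apply: fR | apply: (vf_block blk fid fR)]. Qed.

(* On the line {a_i, b} the operation f is additive modulo h, hence equal to m times each
   of its (equal) one-variable parts. *)
Lemma line_multiple a i b : a \in Bk -> upd a i b \in Bk ->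
  ((h i (e (a i) b) - h i (a i)) *+ m = h i b - h i (a i))%R.
Proof.
move=> aB bB.
have [j ji _] := third_ord i i n3; have [k ki kj] := third_ord i j n3.
have ij : i != j by rewrite eq_sym.
have ik : i != k by rewrite eq_sym.
have jk : j != k by rewrite eq_sym.
have [u0 u0R u0B] := fill j aB; have [u1 u1R u1B] := fill j bB.
have [x0 x0R x0B] := fill k aB; have [x1 x1R x1B] := fill k bB.
pose v (s : seq 'I_m) := f [ffun q => if q \in s then b else a i].
(* The two families of rows agree at [j] after applying [f], and at [k] only argument [q0] varies;
   so the change at [i] equals a change at [k] independent of [s]. *)
have key_step q0 : exists w, forall s, q0 \notin s -> (h i (v (q0 :: s)) - h i (v s) = w)%R.
  pose K y := f [ffun q => if q == q0 then y else a k].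
  exists (h k (K x0) - h k (K x1))%R => s q0s.
  pose J := f [ffun q => if q == q0 then a j else if q \in s then u1 else u0].
  pose base := upd a j J.
  pose rows t y (q : 'I_m) := if q == q0 then upd t k y else
    if q \in s then upd (upd a i b) j u1 else upd a j u0.
  have H0 : total h (vf f (rows a x0)) = 0%R.
    by apply: vf_mem => q; rewrite /rows; do 2!case: ifP => // _.
  have H1 : total h (vf f (rows (upd a i b) x1)) = 0%R.
    by apply: vf_mem => q; rewrite /rows; do 2!case: ifP => // _.
  have E0 : vf f (rows a x0) = upd (upd base i (v s)) k (K x0).
    apply/ffunP=> l; rewrite [LHS]ffunE; case: (eqVneq l k) => [->|lk].
      rewrite upd_eq; congr f; apply/ffunP=> q; rewrite !ffunE /rows.
      by case: ifP => _; [rewrite upd_eq | case: ifP => _; rewrite !upd_neq].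
    rewrite upd_neq //; case: (eqVneq l i) => [->|li].
      rewrite upd_eq; congr f; apply/ffunP=> q; rewrite !ffunE /rows.
      case: (eqVneq q q0) => [->|_]; first by rewrite (negPf q0s) upd_neq.
      by case: ifP => _; rewrite upd_neq // upd_eq.
    rewrite upd_neq //; case: (eqVneq l j) => [->|lj].
      rewrite upd_eq; congr f; apply/ffunP=> q; rewrite !ffunE /rows.
      by case: ifP => _; [rewrite upd_neq | case: ifP => _; rewrite upd_eq].
    rewrite upd_neq // -[RHS]fid; congr f; apply/ffunP=> q; rewrite !ffunE /rows.
    by do 2?[case: ifP => _]; rewrite !upd_neq.
  have E1 : vf f (rows (upd a i b) x1) = upd (upd base i (v (q0 :: s))) k (K x1).
    apply/ffunP=> l; rewrite [LHS]ffunE; case: (eqVneq l k) => [->|lk].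
      rewrite upd_eq; congr f; apply/ffunP=> q; rewrite !ffunE /rows.
      by case: ifP => _; [rewrite upd_eq | case: ifP => _; rewrite !upd_neq].
    rewrite upd_neq //; case: (eqVneq l i) => [->|li].
      rewrite upd_eq; congr f; apply/ffunP=> q; rewrite !ffunE /rows inE.
      case: (eqVneq q q0) => [->|_] /=; first by rewrite upd_neq // upd_eq.
      by case: ifP => _; rewrite upd_neq // upd_eq.
    rewrite upd_neq //; case: (eqVneq l j) => [->|lj].
      rewrite upd_eq; congr f; apply/ffunP=> q; rewrite !ffunE /rows.
      by case: ifP => _; [rewrite !upd_neq | case: ifP => _; rewrite upd_eq].
    rewrite upd_neq // -[RHS]fid; congr f; apply/ffunP=> q; rewrite !ffunE /rows.
    by do 2?[case: ifP => _]; rewrite !upd_neq.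
  move: H0 H1; rewrite E0 E1 !total_upd !(upd_neq _ _ ki) => <- /zmod_swap; exact.
pose w := (h i (e (a i) b) - h i (a i))%R.
have v0 : v [::] = a i by rewrite /v -[RHS]fid; congr f; apply/ffunP=> q; rewrite !ffunE.
have v1 q : v [:: q] = e (a i) b.
  by rewrite /e (fw (a i) b p0 q); congr f; apply/ffunP=> q'; rewrite !ffunE inE.
have vs s : uniq s -> (h i (v s) - h i (a i) = w *+ size s)%R.
  elim: s => [|q s IH] /=; first by rewrite v0 subrr.
  move=> /andP[qs us]; have [w' Hw] := key_step q.
  have ww : w' = w by rewrite -(Hw [::]) // v0 v1.
  by rewrite mulrSr -IH // -ww -(Hw s) // [RHS]addrC subrKA.
have := vs (enum 'I_m) (enum_uniq _); rewrite size_enum_ord => <-.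
by congr (h i _ - _)%R; rewrite /v -[RHS]fid; congr f; apply/ffunP=> q; rewrite !ffunE mem_enum.
Qed.

Let e_block a i b : a \in Bk -> upd a i b \in Bk -> upd a i (e (a i) b) \in Bk.
Proof.
move=> aB bB; have := vf_block blk fid fR (rows := fun p => if p == p0 then upd a i b else a).
have -> : vf f (fun p => if p == p0 then upd a i b else a) = upd a i (e (a i) b).
  apply/ffunP=> l; rewrite [LHS]ffunE; case: (eqVneq l i) => [->|li].
    rewrite upd_eq; congr f; apply/ffunP=> q; rewrite !ffunE.
    by case: ifP => // _; rewrite upd_eq.
  rewrite upd_neq // -[RHS]fid; congr f; apply/ffunP=> q; rewrite !ffunE.
  by case: ifP => // _; rewrite upd_neq.
by apply=> p; case: ifP.
Qed.

(** By [line_multiple], [t] iterations divide the difference from [h i (a i)] by [m ^ t]. Dividing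
    the differences of [b] and of its [N]-th iterate by [m ^ N] yields the same element, as that
    iterate is idempotent. *)
Lemma iter_slot_eq a i b : a \in Bk -> upd a i b \in Bk ->
  h i (iter #|A|`! (e (a i)) b) = h i b.
Proof.
move=> aB bB; set N := #|A|`!.
have itB t : upd a i (iter t (e (a i)) b) \in Bk by elim: t => //= t; apply: e_block.
have mult t x : (forall s, upd a i (iter s (e (a i)) x) \in Bk) ->
    ((h i (iter t (e (a i)) x) - h i (a i)) *+ (m ^ t) = h i x - h i (a i))%R.
  elim: t x => [|t IH] x xB /=; first by rewrite expn0.
  by rewrite expnS mulrnA line_multiple ?IH //; apply: xB.
have E1 := mult N b itB.
have E2 := mult N (iter N (e (a i)) b).
rewrite -iterD iter_fact -/N E1 in E2.
by apply/esym/(@addIr _ (- h i (a i))%R)/E2 => s; rewrite -iterD.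
Qed.

Lemma square_completion a i j b c : i != j -> a \in Bk -> upd a i b \in Bk -> upd a j c \in Bk ->
  upd (upd a i b) j c \in rho_tilde rho.
Proof.
move=> ij aB bB cB; apply/rho_tildeP=> k.
have ji : j != i by rewrite eq_sym.
case: (eqVneq k j) => [->|kj].
  by have [y yR _] := fill j bB; exists y; rewrite upd_upd.
case: (eqVneq k i) => [->|ki].
  by have [y yR _] := fill i cB; exists y; rewrite (updC _ _ _ ij) upd_upd.
have ik : i != k by rewrite eq_sym.
have jk : j != k by rewrite eq_sym.
have [x xR xB] := fill k aB; have [y yR yB] := fill k bB; have [z zR zB] := fill k cB.
pose W u v w := upd (upd (upd a i u) j v) k w.
(* One application of [f] to completed copies of [upd a i b], [upd a j c] and [a] joins the two
   moves in one tuple; further applications iterate both slots. *)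
have climb t : exists w, let r := W (iter t.+1 (e (a i)) b) (iter t.+1 (e (a j)) c) w in
    r \in rho /\ r \in Bk.
  elim: t => [|t [w [rR rB]]].
    pose rows (p : 'I_m) := if p == p0 then upd (upd a i b) k y else
      if p == p1 then upd (upd a j c) k z else upd a k x.
    exists (vf f rows k).
    have <- : vf f rows = W (e (a i) b) (e (a j) c) (vf f rows k).
      apply/ffunP=> l; rewrite /W [RHS]ffunE; case: (eqVneq l k) => [->//|lk].
      rewrite [RHS]ffunE; case: (eqVneq l j) => [->|lj].
        rewrite /e (fw _ _ p0 p1) ffunE; congr f; apply/ffunP=> q; rewrite !ffunE /rows.
        case: (eqVneq q p0) => [->|_]; first by rewrite !upd_neq.
        by case: ifP => _; rewrite upd_neq // upd_eq.
      rewrite [RHS]ffunE; case: (eqVneq l i) => [->|li].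
        rewrite ffunE; congr f; apply/ffunP=> q; rewrite !ffunE /rows.
        by case: ifP => _; [rewrite upd_neq // upd_eq | case: ifP => _; rewrite !upd_neq].
      rewrite ffunE -[RHS]fid; congr f; apply/ffunP=> q; rewrite !ffunE /rows.
      by do 2?[case: ifP => _]; rewrite !upd_neq.
    by split; [apply: fR | apply: (vf_block blk fid fR)] => p; rewrite /rows; do 2!case: ifP => // _.
  set u := iter t.+1 _ b in rR rB *; set v := iter t.+1 _ c in rR rB *.
  pose rows (p : 'I_m) := if p == p0 then W u v w else upd a k x.
  exists (vf f rows k); rewrite (iterS t.+1) (iterS t.+1 _ c) -/u -/v.
  have <- : vf f rows = W (e (a i) u) (e (a j) v) (vf f rows k).
    apply/ffunP=> l; rewrite /W [RHS]ffunE; case: (eqVneq l k) => [->//|lk].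
    rewrite [RHS]ffunE; case: (eqVneq l j) => [->|lj].
      rewrite ffunE; congr f; apply/ffunP=> q; rewrite !ffunE /rows /W.
      by case: ifP => _; rewrite upd_neq // upd_eq.
    rewrite [RHS]ffunE; case: (eqVneq l i) => [->|li].
      rewrite ffunE; congr f; apply/ffunP=> q; rewrite !ffunE /rows /W.
      by case: ifP => _; rewrite upd_neq // upd_neq // upd_eq.
    rewrite ffunE -[RHS]fid; congr f; apply/ffunP=> q; rewrite !ffunE /rows /W.
    by case: ifP => _; rewrite !upd_neq.
  by split; [apply: fR | apply: (vf_block blk fid fR)] => p; rewrite /rows; case: ifP.
have [w] := climb #|A|`!.-1; rewrite prednK ?fact_gt0 //=.
set u := iter _ _ b; set v := iter _ _ c; set r := W u v w => -[rR rB].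
(* An entry may be exchanged for one with the same [h]: the total stays 0, and [sol] covers this
   step although it may leave the block. *)
have move_to d l t s : d \in rho -> d \in Bk -> upd a l t \in Bk -> d l = s -> h l s = h l t ->
    upd d l t \in rho /\ upd d l t \in Bk.
  move=> dR dB tB dl hl.
  have uR : upd d l t \in rho.
    rewrite sol //; last by exists (upd a l t) => //; rewrite upd_eq.
    by rewrite total_upd total0 // dl hl subrr addr0.
  by split=> //; apply: (block_step blk) => //; apply: rho_sub_tilde.
have [r1R r1B] : upd r i b \in rho /\ upd r i b \in Bk.
  apply: (move_to r i b u) => //; last exact: iter_slot_eq.
  by rewrite /r /W upd_neq // upd_neq // upd_eq.
have [r2R _] : upd (upd r i b) j c \in rho /\ upd (upd r i b) j c \in Bk.
  apply: (move_to _ j c v) => //; last exact: iter_slot_eq.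
  by rewrite upd_neq // /r /W upd_neq // upd_eq.
exists w; move: r2R; congr (_ \in rho); rewrite /r /W; apply/ffunP=> l; rewrite !ffunE.
case: (eqVneq l k) => [->|_]; first by rewrite (negPf kj) (negPf ki).
by case: eqP => // _; case: eqP.
Qed.

End Square.
End KeyBlocks.

(** * The group equation on a box, and the theorem *)

Lemma block_group (A : finType) n (rho Bk : {set tup A n}) (Bs : 'I_n -> {set A})
    (H : zmodType) (h : 'I_n -> A -> H) (p N : nat) :
  2 < n -> is_block rho Bk -> Bk = box Bs -> prime p ->
  (forall i x, (h i x *+ (p ^ N) = 0)%R) -> block_solution rho Bk h ->
  exists (G : finZmodType) (k : nat) (phi : 'I_n -> A -> G),
    [/\ #|G| = (p ^ k)%N,
        (forall (i : 'I_n) (g : G), exists2 x, x \in Bs i & phi i x = g)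
      & rho :&: Bk = [set a in Bk | (\sum_(i < n) phi i (a i) == 0)%R]].
Proof.
move=> n3 blk BkE p_pr kill sol.
have mem c : c \in Bk -> (c \in rho) = (total h c == 0)%R by exact: block_solution_mem.
have inBs c i : c \in Bk -> c i \in Bs i by rewrite BkE => /boxP.
have fill c i : c \in Bk -> exists b, [/\ b \in Bs i, upd c i b \in Bk & upd c i b \in rho].
  move=> cB; have [b bR] := rho_tildeP _ _ (block_tilde blk cB) i.
  have uB : upd c i b \in Bk by apply: (block_step blk) => //; apply: rho_sub_tilde.
  by exists b; split=> //; have := inBs _ i uB; rewrite upd_eq.
have i0 : 'I_n := Ordinal (ltnW (ltnW n3)).
have [o oB oR] : exists2 o, o \in Bk & o \in rho.
  have [a aB] := block_nonempty blk; have [b [_ bB bR]] := fill a i0 aB.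
  by exists (upd a i0 b).
have o0 : (total h o = 0)%R by apply/eqP; rewrite -mem.
pose dl i x := (h i x - h i (o i))%R.
(* Since any two entries of a box can be compensated at a third place, the centred images [V i]
   coincide and form one subgroup of [H]. *)
pose V i v := exists2 x, x \in Bs i & dl i x = v.
have V0 i : V i 0%R by exists (o i); [apply: inBs | rewrite /dl subrr].
have updB c i x : c \in Bk -> x \in Bs i -> upd c i x \in Bk.
  by rewrite BkE; apply: box_upd.
have VDN i j l u v : j != i -> l != i -> l != j -> V i u -> V j v -> V l (- (u + v))%R.
  move=> ji li lj [x xB <-] [y yB <-].
  have xyB : upd (upd o i x) j y \in Bk by do 2!apply: (updB) => //.
  have [z [zBs zB zR]] := fill _ l xyB; exists z => //.
  move: zR; rewrite mem // !total_upd o0 add0r !upd_neq // => /eqP.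
  by move/(canRL (addKr _)); rewrite addr0.
have VN i j u : j != i -> V i u -> V j (- u)%R.
  move=> ji Vu; have [l li lj] := third_ord i j n3.
  have jl : j != l by rewrite eq_sym.
  by have := VDN i l j u 0%R li ji jl Vu (V0 l); rewrite addr0.
have Vij i j u : V i u -> V j u.
  move=> Vu; case: (eqVneq j i) => [->//|ji]; have [l li lj] := third_ord i j n3.
  have jl : j != l by rewrite eq_sym.
  by have := VN l j _ jl (VN i l _ li Vu); rewrite opprK.
have [i1 i10 _] := third_ord i0 i0 n3; have [i2 i20 i21] := third_ord i0 i1 n3.
have VO u : V i0 u -> V i0 (- u)%R by move=> /(VN _ i1 _ i10) /(Vij _ i0).
have VD u v : V i0 u -> V i0 v -> V i0 (u + v)%R.
  move=> Vu /(Vij _ i1) Vv.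
  have := VO _ (Vij _ i0 _ (VDN i0 i1 i2 u v i10 i20 i21 Vu Vv)).
  by rewrite opprK.
(* [H] need not be finite; listing the subgroup turns it into a finite type. *)
pose vs : seq H := [seq dl i0 x | x <- enum (Bs i0)].
have vsP v : reflect (V i0 v) (v \in vs).
  apply: (iffP mapP) => [[x xB ->]|[x xB <-]]; exists x => //; by rewrite mem_enum in xB *.
pose T : finType := seq_sub vs.
have inV (t : T) : V i0 (val t) by apply/vsP/valP.
pose mk v (Vv : V i0 v) : T := SeqSub (introT (vsP v) Vv).
pose add (s t : T) := mk _ (VD _ _ (inV s) (inV t)).
pose opp (s : T) := mk _ (VO _ (inV s)).
pose zero := mk _ (V0 i0).
have addA : associative add by move=> x y z; apply: val_inj; apply: addrA.
have addC : commutative add by move=> x y; apply: val_inj; apply: addrC.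
have add0 : left_id zero add by move=> x; apply: val_inj; apply: add0r.
have addN : left_inverse zero opp add by move=> x; apply: val_inj; apply: addNr.
have [G [to [[from toK fromK] toD to0]]] := finZmod_of addA addC add0 addN.
pose w (g : G) : H := val (from g).
have w_inj : injective w by move=> g g' /val_inj/(can_inj fromK).
have wD : {morph w : g g' / (g + g')%R}.
  move=> g g'; rewrite /w -[X in val X = _](toK) -{1}(fromK g) -{1}(fromK g') -toD !toK //.
have w0 : w 0%R = 0%R by rewrite /w -to0 toK.
have wMn g k : w (g *+ k)%R = (w g *+ k)%R by elim: k => // k IH; rewrite !mulrS wD IH.
pose phi i x : G := to (insubd zero (dl i x)).
have wphi i x : x \in Bs i -> w (phi i x) = dl i x.
  move=> xB; rewrite /w /phi toK insubdK //; apply/vsP; apply: (Vij i); by exists x.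
have [k Gk] : exists k, #|G| = (p ^ k)%N.
  apply: (@card_pexp G p N p_pr) => g; apply: w_inj; rewrite wMn w0.
  have [x xB xg] := inV (from g); rewrite /w -xg.
  by rewrite /dl mulrnBl !kill subrr.
exists G, k, phi; split=> //.
  move=> i g; have [x xB xg] := Vij _ i _ (inV (from g)).
  by exists x => //; apply: w_inj; rewrite wphi.
apply/setP=> a; rewrite !in_set andbC; case: (boolP (a \in Bk)) => //= aB.
rewrite mem // -(inj_eq w_inj) w0 (big_morph w wD w0).
rewrite (eq_bigr (fun i => dl i (a i))); last by move=> i _; apply/wphi/inBs.
by rewrite sumrB -[X in (_ - X)%R]/(total h o) o0 subr0.
Qed.

Theorem mainTheorem11 (A : finType) (n : nat) (rho : {set tup A n}) :
  (3 <= n)%N ->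
  essential_rel rho -> key_relation rho -> preserved_by_WNU rho -> full_pattern rho ->
  (forall Bk : {set tup A n}, is_block rho Bk ->
     exists Bs : 'I_n -> {set A}, Bk = box Bs) /\
  (forall (Bk : {set tup A n}) (Bs : 'I_n -> {set A}),
     is_block rho Bk -> ~~ trivial_block rho Bk -> Bk = box Bs ->
     exists (G : finZmodType) (p k : nat) (phi : 'I_n -> A -> G),
       [/\ prime p, #|G| = (p ^ k)%N,
           (forall (i : 'I_n) (g : G), exists2 x, x \in Bs i & phi i x = g)
         & rho :&: Bk = [set a in Bk | (\sum_(i < n) phi i (a i) == 0)%R]]).
Proof.
move=> n3 _ [beta [betaR key]] wnu /full_pattern_rectangular rect.
(* The key map from an essential tuple to [beta] carries its completions along, so [beta] is
   essential once any essential tuple exists. *)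
have beta_ess a : a \in rho_tilde rho -> a \notin rho -> forall i, exists b, upd beta i b \in rho.
  move=> /rho_tildeP at_ aR i; have [Psi [PR <-]] := key a aR; have [b bR] := at_ i.
  by exists (Psi i b); rewrite -vapply_upd; apply: PR.
split=> [Bk blk|Bk Bs blk nontriv BkE].
  apply: (block_box blk) => a i j x y ij aB xB yB.
  (* Without essential tuples every block lies in [rho], and rectangularity alone fills the
     square. *)
  have [sub|/subsetPn[c ct cR]] := boolP (rho_tilde rho \subset rho).
    have tR c : c \in Bk -> c \in rho by move=> cB; apply: (subsetP sub); apply: (block_tilde blk).
    apply: rho_sub_tilde; apply: (rect i j a x (a i) y (a j) ij).
    - by rewrite upd_id tR.
    - by rewrite updC // upd_id tR.
    by rewrite !upd_id tR.
  have [H [h [p [k [_ _ sol]]]]] := block_embedding n3 rect betaR (beta_ess c ct cR) key wnu blk.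
  have [m [f [fwnu fR]]] := wnu.
  exact: (square_completion n3 blk sol fwnu fR ij aB xB yB).
have [c cB cR] := subsetPn nontriv.
have ct := block_tilde blk cB.
have [H [h [p [N [p_pr kill sol]]]]] := block_embedding n3 rect betaR (beta_ess c ct cR) key wnu blk.
have [G [k [phi [Gk surj eqn]]]] := block_group n3 blk BkE p_pr kill sol.
by exists G, p, k, phi.
Qed.
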